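(* Let $n\ge 2$, $m\ge 0$ and $F=\sum_{p=0}^m f^{(p)}\in\mathcal{E}'(\mathbf{S}^m)$. Then for every integer $j$ with $0\le j\le m$ and all indices $1\le i_1,\dots,i_j\le n$, $$I^0 f^{(j)}_{i_1\dots i_j}=(-1)^{m-j}\frac{\sigma(i_1\dots i_j)}{(m-j)!\,j!}\,P_{m-j}(\xi,\partial_\xi)\sum_{k=0}^{j}(-1)^k\binom{j}{k}\frac{\partial^{j}(I^{m,k}F)}{\partial x^{i_1}\cdots\partial x^{i_k}\,\partial\xi^{i_{k+1}}\cdots\partial\xi^{i_j}},$$ where the right-hand side is understood in the sense of distributions on $\mathbb{R}^n\times(\mathbb{R}^n\setminus\{0\})$.
   Context: Repeated indices are summed from $1$ to $n$. $\mathcal{E}'(S^p)$ denotes the space of symmetric $p$-tensor fields on $\mathbb{R}^n$ whose components are compactly supported distributions, and $\mathcal{E}'(\mathbf{S}^m)=\bigoplus_{p=0}^m\mathcal{E}'(S^p)$; an element is written $F=\sum_{p=0}^m f^{(p)}$ with $f^{(p)}=(f^{(p)}_{i_1\cdots i_p})\in\mathcal{E}'(S^p)$. For an integer $k\ge 0$ and $f\in\mathcal{E}'(S^p)$, the momentum ray transform $I^kf\in\mathcal{D}'(\mathbb{R}^n\times(\mathbb{R}^n\setminus\{0\}))$ is defined by $\langle I^kf,\psi\rangle=\langle f,(I^k)^*\psi\rangle$ for $\psi\in C_c^\infty(\mathbb{R}^n\times(\mathbb{R}^n\setminus\{0\}))$, where $[(I^k)^*\psi]_{i_1\cdots i_p}(x)=\int_{\mathbb{R}^n}\int_{\mathbb{R}}t^k\,\xi^{i_1}\cdots\xi^{i_p}\,\psi(x-t\xi,\xi)\,dt\,d\xi$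 (the pairing of tensors sums over all indices). The generalized momentum ray transform is $I^{m,k}F=\sum_{p=0}^m I^kf^{(p)}$. For smooth compactly supported $F$ it is $I^{m,k}F(x,\xi)=\sum_{p=0}^m\int_{-\infty}^\infty t^k f^{(p)}_{i_1\cdots i_p}(x+t\xi)\,\xi^{i_1}\cdots\xi^{i_p}\,dt$. In the formula, $I^0f^{(j)}_{i_1\dots i_j}$ is the transform $I^0$ applied to the scalar distribution $f^{(j)}_{i_1\dots i_j}$ (for fixed indices); $\sigma(i_1\dots i_j)$ is symmetrization (average over all permutations) in the listed indices; and $P_k(\xi,\partial_\xi)=\xi^{i_1}\cdots\xi^{i_k}\frac{\partial^k}{\partial\xi^{i_1}\cdots\partial\xi^{i_k}}$ (with $P_0$ the identity). *)

(* Defs.v *)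
From HB Require Import structures.
From mathcomp Require Import all_boot all_order all_fingroup all_algebra.
From mathcomp Require Import all_classical all_reals all_analysis.
From mathcomp Require Export complex.

Set Implicit Arguments.
Unset Strict Implicit.
Unset Printing Implicit Defensive.

Import Order.TTheory GRing.Theory Num.Theory.
Import numFieldNormedType.Exports.

Local Open Scope classical_set_scope.
Local Open Scope ring_scope.
Local Open Scope complex_scope.

(** * Smooth functions and test functions *)

Definition iterD (R : realType) (V : normedModType R) (f : V -> R)
    (vs : seq V) : V -> R :=
  foldr (fun (v : V) (g : V -> R) => 'D_v g) f vs.

(* In finite dimension this is C^oo: every iterated directional derivative is
   differentiable, hence also continuous, at every point. *)
Definition smooth (R : realType) (V : normedModType R) (f : V -> R) : Prop :=
  forall (vs : seq V) (x : V), differentiable (iterD f vs) x.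

Definition closed_support (R : realType) (V : normedModType R) (f : V -> R) : set V :=
  closure [set z | f z != 0].

(* C_c^oo(R^n x (R^n \ {0})); the elements are extended by zero to
   R^n x R^n, and a point of the domain is z = (x, xi). *)
Definition test_function (R : realType) (n : nat)
    (psi : 'rV[R]_n * 'rV[R]_n -> R) : Prop :=
  [/\ smooth psi, compact (closed_support psi) &
      closed_support psi `<=` [set z | z.2 != 0]].

(** * Distributions *)

(* Distributions are complex valued.  They are represented by their values on
   real valued functions: a C-linear functional on complex valued functions is
   the same thing as an R-linear, C-valued one on real valued functions.
   A functional is a total map; only its values on smooth functions (for E')
   or on test functions (for D') are meaningful, so that two functionals
   represent the same distribution when they agree there. *)
Definition functional (R : realType) (V : Type) : Type := (V -> R) -> R[i].

Definition basis_vec (R : realType) (n : nat) (i : 'I_n) : 'rV[R]_n :=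
  delta_mx 0 i.

(* E'(R^n), the dual of C^oo(R^n): continuity is the usual seminorm estimate
   |u(phi)| <= C max_{|alpha| <= N} sup_K |d^alpha phi|. *)
Definition compactly_supported_distribution (R : realType) (n : nat)
    (u : functional R 'rV[R]_n) : Prop :=
  (forall (a : R) (phi chi : 'rV[R]_n -> R), smooth phi -> smooth chi ->
     u (fun x => a * phi x + chi x) = a%:C * u phi + u chi) /\
  (exists (K : set 'rV[R]_n) (N : nat) (C : R),
     compact K /\
     forall (phi : 'rV[R]_n -> R) (M : R), smooth phi -> 0 <= M ->
       (forall (al : seq 'I_n) (x : 'rV[R]_n), (size al <= N)%N -> K x ->
          `|iterD phi [seq basis_vec R i | i <- al] x| <= M) ->
       `|u phi| <= (C * M)%:C).

(** * Tensor fields *)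

(* A tensor field of rank p is given by its components f_{i_1 ... i_p}. *)
Definition tensor_field (R : realType) (n p : nat) : Type :=
  p.-tuple 'I_n -> functional R 'rV[R]_n.

Definition perm_tuple (T : Type) (p : nat) (s : 'S_p) (i : p.-tuple T) :
    p.-tuple T :=
  [tuple tnth i (s a) | a < p].

(* E'(S^p) *)
Definition symmetric_tensor_distribution (R : realType) (n p : nat)
    (f : tensor_field R n p) : Prop :=
  (forall i : p.-tuple 'I_n, compactly_supported_distribution (f i)) /\
  (forall (s : 'S_p) (i : p.-tuple 'I_n) (phi : 'rV[R]_n -> R),
     smooth phi -> f (perm_tuple s i) phi = f i phi).

(* A family F = f^(0) + ... + f^(m), with components in E'(S^p) *)
Definition mixed_tensor_field (R : realType) (n m : nat) : Type :=
  forall p : 'I_m.+1, tensor_field R n p.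

Definition mixed_tensor_distribution (R : realType) (n m : nat)
    (F : mixed_tensor_field R n m) : Prop :=
  forall p : 'I_m.+1, symmetric_tensor_distribution (F p).

Definition scalar_field (R : realType) (n : nat) (u : functional R 'rV[R]_n) :
    tensor_field R n 0 :=
  fun=> u.

(** * Momentum ray transforms *)

(* The Lebesgue integral over R^n, one coordinate at a time (it is applied to
   compactly supported continuous functions only). *)
Fixpoint integral_Rn (R : realType) (n : nat) : ('rV[R]_n -> R) -> R :=
  match n with
  | 0 => fun f => f 0
  | n'.+1 => fun f =>
      \int[@lebesgue_measure R]_t
        integral_Rn (fun y : 'rV[R]_n' => f (row_mx (t%:M : 'M[R]_1) y))
  end.

Definition monomial (R : realType) (n p : nat) (i : p.-tuple 'I_n)
    (xi : 'rV[R]_n) : R :=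
  \prod_(a < p) xi 0 (tnth i a).

(* The component of index i of (I^k)^* psi *)
Definition momentum_adjoint (R : realType) (n k p : nat) (i : p.-tuple 'I_n)
    (psi : 'rV[R]_n * 'rV[R]_n -> R) : 'rV[R]_n -> R :=
  fun x => integral_Rn (fun xi : 'rV[R]_n =>
    \int[@lebesgue_measure R]_t
      (t ^+ k * monomial i xi * psi (x - t *: xi, xi))).

(* I^k f *)
Definition momentum_ray (R : realType) (n k p : nat) (f : tensor_field R n p) :
    functional R ('rV[R]_n * 'rV[R]_n) :=
  fun psi => \sum_(i : p.-tuple 'I_n) f i (momentum_adjoint k i psi).

(* I^{m,k} F *)
Definition generalized_momentum_ray (R : realType) (n m k : nat)
    (F : mixed_tensor_field R n m) : functional R ('rV[R]_n * 'rV[R]_n) :=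
  fun psi => \sum_(p < m.+1) momentum_ray k (F p) psi.

(** * Operations on distributions on R^n x (R^n \ {0}) *)

Definition dist_dx (R : realType) (n : nat) (i : 'I_n)
    (u : functional R ('rV[R]_n * 'rV[R]_n)) :
    functional R ('rV[R]_n * 'rV[R]_n) :=
  fun psi => - u ('D_(basis_vec R i, 0) psi).

Definition dist_dxi (R : realType) (n : nat) (i : 'I_n)
    (u : functional R ('rV[R]_n * 'rV[R]_n)) :
    functional R ('rV[R]_n * 'rV[R]_n) :=
  fun psi => - u ('D_(0, basis_vec R i) psi).

Definition dist_dxs (R : realType) (n : nat) (l : seq 'I_n)
    (u : functional R ('rV[R]_n * 'rV[R]_n)) :
    functional R ('rV[R]_n * 'rV[R]_n) :=
  foldr (@dist_dx R n) u l.

Definition dist_dxis (R : realType) (n : nat) (l : seq 'I_n)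
    (u : functional R ('rV[R]_n * 'rV[R]_n)) :
    functional R ('rV[R]_n * 'rV[R]_n) :=
  foldr (@dist_dxi R n) u l.

Definition dist_mulxi (R : realType) (n p : nat) (i : p.-tuple 'I_n)
    (u : functional R ('rV[R]_n * 'rV[R]_n)) :
    functional R ('rV[R]_n * 'rV[R]_n) :=
  fun psi => u (fun z => monomial i z.2 * psi z).

(* P_k(xi, d_xi) *)
Definition dist_P (R : realType) (n k : nat)
    (u : functional R ('rV[R]_n * 'rV[R]_n)) :
    functional R ('rV[R]_n * 'rV[R]_n) :=
  fun psi => \sum_(l : k.-tuple 'I_n) dist_mulxi l (dist_dxis l u) psi.

(* sigma(i_1 ... i_j) *)
Definition symmetrize (R : realType) (n j : nat)
    (T : j.-tuple 'I_n -> functional R ('rV[R]_n * 'rV[R]_n)) :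
    j.-tuple 'I_n -> functional R ('rV[R]_n * 'rV[R]_n) :=
  fun i psi => (j`!%:R)^-1 * \sum_(s : 'S_j) T (perm_tuple s i) psi.

(* sum_{k=0}^j (-1)^k C(j,k) d^j (I^{m,k} F) /
     (dx^{i_1} ... dx^{i_k} dxi^{i_{k+1}} ... dxi^{i_j}) *)
Definition alternating_sum (R : realType) (n m j : nat)
    (F : mixed_tensor_field R n m) (i : j.-tuple 'I_n) :
    functional R ('rV[R]_n * 'rV[R]_n) :=
  fun psi => \sum_(k < j.+1) (-1) ^+ k * 'C(j, k)%:R *
    dist_dxs (take k i) (dist_dxis (drop k i)
      (generalized_momentum_ray k F)) psi.

(* Main.v *)
Require Import Defs.
From HB Require Import structures.
From mathcomp Require Import all_boot all_order all_fingroup all_algebra.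
From mathcomp Require Import all_classical all_reals all_analysis.
From mathcomp Require Import ring lra zify.

(** The transform is defined by duality, so every term of the formula is of the
form u (A_k chi), where u is a component of F and

  A_k chi (x) = \int_xi \int_t t^k chi (x - t xi, xi) dt dxi

([ray_adjoint]).  Since chi is compactly supported away from xi = 0, A_k chi is
smooth, and the theorem reduces, by linearity of the components of F, to
identities between the functions A_k chi.  Write X_y, Y_y for the derivatives in
x_y, xi_y.

Integration by parts gives two rules.  Integrating the xi-derivative of
t^k chi (x - t xi, xi) yields A_k Y_y = A_{k+1} X_y ([ray_adjoint_dxi]).
Integrating the t-derivative of t chi (x - t xi, xi) yields
A_1 (sum_y X_y xi_y chi) = A_0 chi, hence, by the first rule,
A_0 (sum_y Y_y xi_y chi) = A_0 chi ([ray_adjoint_div_xi]): the dual form of the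
fact that the ray transform of a scalar field is homogeneous of degree -1 in xi.

The sum over k.  With a polynomial weight q(xi), the first rule reads
A_k (q Y_y chi) = A_{k+1} (q X_y chi) - A_k ((d_y q) chi).  Thus, up to
reordering, each Y_y that is removed either becomes X_y and raises k, or
differentiates the weight.  In the alternating binomial sum, symmetrized over
the indices, all the terms in which some X_y survives cancel: this is Pascal's
rule applied j times ([alternation_sum]).  What remains is j! times
A_0 ((d_{i_1} ... d_{i_j} xi^I) chi), with I the multi-index of the component.

The operator P_{m-j}.  The weight d_{i_1} ... d_{i_j} xi^I has degree p - j when
I has length p, and under A_0 the adjoint of P_k then acts on it, up to the sign
(-1)^k, as the number (1 - q)(2 - q) ... (k - q) with q = p - j
([ray_adjoint_iter_div_xi]).  For k = m - j this is 0 when j < p <= m and (m-j)! when p = j, while for p < j the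
weight itself is 0.  Only f^(j) survives, and since f^(j) is symmetric its
contraction with the constants d_{i_1} ... d_{i_j} xi^I is j! times its component
of index i ([symmetric_contraction]).

Most of the text builds the analysis that these rules need: closure of smooth
functions under products and composition, symmetry of mixed derivatives
([deriveC]), and Frechet differentiation under an integral sign
([param_integral_differential], [param_integral_Rn_smooth]). *)

Set Implicit Arguments.
Unset Strict Implicit.
Unset Printing Implicit Defensive.

Import Order.TTheory GRing.Theory Num.Theory.
Import numFieldNormedType.Exports.

Local Open Scope classical_set_scope.
Local Open Scope ring_scope.

Local Notation iterD := Defs.iterD.

(** * Calculus of smooth functions *)

Section SmoothCalculus.
Context {R : realType}.
Implicit Types (V W : normedModType R).

Lemma iterD_cat V (f : V -> R) (vs ws : seq V) :
  iterD f (vs ++ ws) = iterD (iterD f ws) vs.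
Proof. by rewrite /iterD foldr_cat. Qed.

Lemma smooth_differentiable V (f : V -> R) x : smooth f -> differentiable f x.
Proof. by move=> /(_ [::] x). Qed.

Lemma smooth_derivable V (f : V -> R) x v : smooth f -> derivable f x v.
Proof. by move=> sf; apply/diff_derivable/smooth_differentiable. Qed.

Lemma smooth_continuous V (f : V -> R) : smooth f -> continuous f.
Proof.
by move=> sf x; apply/differentiable_continuous/smooth_differentiable.
Qed.

Lemma smooth_iterD V (f : V -> R) vs : smooth f -> smooth (iterD f vs).
Proof. by move=> sf ws x; rewrite -iterD_cat; exact: sf. Qed.

Lemma smooth_derive V (f : V -> R) v : smooth f -> smooth ('D_v f).
Proof. exact: (@smooth_iterD _ _ [:: v]). Qed.

(** The way smoothness is proved throughout: a class of differentiable functions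
that is stable under directional derivatives consists of smooth functions. *)
Lemma smooth_closure V (P : (V -> R) -> Prop) :
  (forall f x, P f -> differentiable f x) ->
  (forall f v, P f -> P ('D_v f)) ->
  forall f, P f -> smooth f.
Proof.
move=> Pdiff PD f Pf vs; suff: P (iterD f vs) by move=> H x; exact: Pdiff.
by elim: vs => [//|v vs IH] /=; apply: PD.
Qed.

Lemma deriveDE V (f g : V -> R) v : smooth f -> smooth g ->
  'D_v (fun x => f x + g x) = (fun x => 'D_v f x + 'D_v g x).
Proof.
by move=> sf sg; apply/funext => x; rewrite (deriveD (smooth_derivable sf)
  (smooth_derivable sg)).
Qed.

Lemma smoothD V (f g : V -> R) : smooth f -> smooth g ->
  smooth (fun x => f x + g x).
Proof.
move=> sf sg.
apply: (@smooth_closure _ (fun h => exists f g, [/\ smooth f, smooth g &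
   h = fun x => f x + g x])); last by exists f, g.
- move=> _ x [f1 [g1 [sf1 sg1 ->]]].
  by apply: differentiableD; exact: smooth_differentiable.
- move=> _ v [f1 [g1 [sf1 sg1 ->]]]; exists ('D_v f1), ('D_v g1).
  by rewrite deriveDE//; split => //; exact: smooth_derive.
Qed.

Lemma deriveME V (f g : V -> R) v : smooth f -> smooth g ->
  'D_v (fun x => f x * g x) = (fun x => 'D_v f x * g x + f x * 'D_v g x).
Proof.
move=> sf sg; apply/funext => x; rewrite (deriveM (smooth_derivable sf)
  (smooth_derivable sg)) /= addrC; congr (_ + _).
by rewrite /GRing.scale/= mulrC.
Qed.

(** Products alone are not stable under differentiation, because of the Leibniz
rule; finite sums of products are. *)
Inductive product_sum V : (V -> R) -> Prop :=
| product_sum_mul f g : smooth f -> smooth g ->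
    product_sum (fun x => f x * g x)
| product_sum_add h1 h2 : product_sum h1 -> product_sum h2 ->
    product_sum (fun x => h1 x + h2 x).

Lemma product_sum_differentiable V (h : V -> R) x :
  product_sum h -> differentiable h x.
Proof.
elim=> {h} [f g sf sg|h1 h2 _ IH1 _ IH2].
  by apply: differentiableM; exact: smooth_differentiable.
exact: differentiableD.
Qed.

Lemma smoothM V (f g : V -> R) : smooth f -> smooth g ->
  smooth (fun x => f x * g x).
Proof.
move=> sf sg; apply: (@smooth_closure _ (@product_sum V)).
- by move=> h x /product_sum_differentiable.
- move=> h v; elim=> {h} [h1 h2 s1 s2|h1 h2 p1 IH1 p2 IH2].
    by rewrite deriveME//; do 2 constructor => //; exact: smooth_derive.
  have -> : 'D_v (fun x => h1 x + h2 x) = (fun x => 'D_v h1 x + 'D_v h2 x).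
    apply/funext => x; rewrite (@deriveD _ _ _ h1 h2)//;
      exact/diff_derivable/product_sum_differentiable.
  exact: product_sum_add.
- exact: product_sum_mul.
Qed.

Lemma derive_cstE V (a : R) (v : V) : 'D_v (fun=> a) = (fun=> 0).
Proof. by apply/funext => x; exact: derive_cst. Qed.

Lemma smooth_cst V (a : R) : smooth (fun _ : V => a).
Proof.
apply: (@smooth_closure _ (fun h => exists a, h = fun=> a)); last by exists a.
- by move=> _ x [b ->]; exact: differentiable_cst.
- by move=> _ v [b ->]; rewrite derive_cstE; exists 0.
Qed.

Lemma smoothN V (f : V -> R) : smooth f -> smooth (fun x => - f x).
Proof.
move=> sf; have -> : (fun x => - f x) = (fun x => -1 * f x).
  by apply/funext => x; rewrite mulN1r.
by apply: smoothM => //; exact: smooth_cst.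
Qed.

Lemma smooth_sum V (I : Type) (r : seq I) (f : I -> V -> R) :
  (forall i, smooth (f i)) -> smooth (fun x => \sum_(i <- r) f i x).
Proof.
move=> sf; elim: r => [|i r IH].
  have -> : (fun x => \sum_(i <- [::]) f i x) = (fun=> 0).
    by apply/funext => x; rewrite big_nil.
  exact: smooth_cst.
have -> : (fun x => \sum_(i <- i :: r) f i x) =
    (fun x => f i x + \sum_(i <- r) f i x).
  by apply/funext => x; rewrite big_cons.
exact: smoothD.
Qed.

Lemma smoothX V (f : V -> R) k : smooth f -> smooth (fun x => f x ^+ k).
Proof.
move=> sf; elim: k => [|k IH]; first exact: smooth_cst.
have -> : (fun x => f x ^+ k.+1) = (fun x => f x * f x ^+ k).
  by apply/funext => x; rewrite exprS.
exact: smoothM.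
Qed.

Lemma deriveZE V (f : V -> R) (a : R) v : smooth f ->
  'D_v (fun x => a * f x) = (fun x => a * 'D_v f x).
Proof.
move=> sf; rewrite deriveME//; last exact: smooth_cst.
by apply/funext => x; rewrite derive_cst mul0r add0r.
Qed.

Lemma derive_sumE V (I : Type) (r : seq I) (f : I -> V -> R) v :
  (forall i, smooth (f i)) ->
  'D_v (fun x => \sum_(i <- r) f i x) = (fun x => \sum_(i <- r) 'D_v (f i) x).
Proof.
move=> sf; elim: r => [|i r IH].
  have -> : (fun x => \sum_(i <- [::]) f i x) = (fun=> 0).
    by apply/funext => x; rewrite big_nil.
  by rewrite derive_cstE; apply/funext => x; rewrite big_nil.
have -> : (fun x => \sum_(i <- i :: r) f i x) =
    (fun x => f i x + \sum_(i <- r) f i x).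
  by apply/funext => x; rewrite big_cons.
rewrite deriveDE; [|exact: sf|exact: smooth_sum].
apply/funext => x; rewrite big_cons; congr (_ + _).
exact: (congr1 (@^~ x) IH).
Qed.

Lemma derive_linE V (f : {linear V -> R^o}) v : continuous (f : V -> R) ->
  'D_v (f : V -> R) = (fun=> f v).
Proof.
move=> cf; apply/funext => x; rewrite deriveE; last first.
  exact: linear_differentiable.
by rewrite (@diff_lin R V R f).
Qed.

Lemma smooth_lin V (f : {linear V -> R^o}) : continuous (f : V -> R) ->
  smooth (f : V -> R).
Proof.
move=> cf.
apply: (@smooth_closure _ (fun h => h = f :> (V -> R) \/ smooth h)); last by left.
- by move=> h x [->|/smooth_differentiable//]; exact: linear_differentiable.
- move=> h v [->|sh]; right; last exact: smooth_derive.
  by rewrite derive_linE//; exact: smooth_cst.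
Qed.

End SmoothCalculus.

(** * Symmetry of second derivatives *)

Section Schwarz.
Context {R : realType}.
Implicit Types (V W : normedModType R).

Lemma is_derive_line V (f : V -> R) (x v : V) (s : R) :
  smooth f -> is_derive s 1 (fun s : R => f (x + s *: v)) ('D_v f (x + s *: v)).
Proof.
move=> sf; have dl := smooth_derivable (x:=x + s *: v) (v:=v) sf.
have E : (fun h => h^-1 *: (((fun s : R => f (x + s *: v)) \o shift s) (h *: (1 : R))
      - f (x + s *: v))) =
    (fun h => h^-1 *: ((f \o shift (x + s *: v)) (h *: v) - f (x + s *: v))).
  apply/funext => h /=; congr (_ *: (f _ - _)).
  by rewrite /shift/= [h *: _]mulr1 scalerDl addrCA.
apply: DeriveDef; first by rewrite /derivable E.
by rewrite /derive E.
Qed.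

(** A directional derivative only sees the restriction to a line: if g maps the
line through x directed by u affinely onto the line directed by w, no chain rule
(hence no differential of g) is needed. *)
Lemma derive_along V W (f : W -> R) (g : V -> W) (x u : V) (w : W) :
  (forall s : R, g (s *: u + x) = s *: w + g x) ->
  'D_u (f \o g) x = 'D_w f (g x).
Proof.
move=> gE; rewrite /derive.
suff -> : (fun h => h^-1 *: (((f \o g) \o shift x) (h *: u) - (f \o g) x))
  = (fun h => h^-1 *: ((f \o shift (g x)) (h *: w) - f (g x))) by [].
by apply/funext => h /=; rewrite gE.
Qed.

Lemma derive_invariant V (a : V -> R) (x u : V) :
  (forall s : R, a (s *: u + x) = a x) -> 'D_u a x = 0.
Proof.
move=> aE; have <- : 'D_u (cst (a x)) x = 0 by exact: derive_cst.
rewrite /derive.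
suff -> : (fun h => h^-1 *: ((a \o shift x) (h *: u) - a x))
  = (fun h => h^-1 *: ((cst (a x) \o shift x) (h *: u) - cst (a x) x)) by [].
by apply/funext => h /=; rewrite aE.
Qed.

Lemma mean_value_line V (f : V -> R) (x v : V) (h : R) : smooth f -> 0 < h ->
  exists2 s, 0 < s < h & f (x + h *: v) - f x = h * 'D_v f (x + s *: v).
Proof.
move=> sf h0.
have dF s := is_derive_line x v s sf.
have cF : continuous (fun s : R => f (x + s *: v)).
  by move=> s; apply/differentiable_continuous/derivable1_diffP; case: (dF s).
have [s s0h E] := MVT h0 (fun s _ => dF s) (continuous_subspaceT cF).
exists s; first by move: s0h; rewrite in_itv.
by move: E; rewrite scale0r addr0 subr0 mulrC.
Qed.

Lemma derive_translate V (f : V -> R) (a v : V) :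
  'D_v (fun x => f (x + a)) = (fun x => 'D_v f (x + a)).
Proof.
apply/funext => x; rewrite /derive.
suff -> : (fun h => h^-1 *: (((fun x => f (x + a)) \o shift x) (h *: v) - f (x + a)))
  = (fun h => h^-1 *: ((f \o shift (x + a)) (h *: v) - f (x + a))) by [].
by apply/funext => h /=; rewrite addrA.
Qed.

Lemma smooth_translate V (f : V -> R) (a : V) :
  smooth f -> smooth (fun x => f (x + a)).
Proof.
move=> sf.
apply: (@smooth_closure _ _ (fun h => exists2 f, smooth f & h = fun x => f (x + a)));
  last by exists f.
- move=> _ x [g sg ->]; apply: (@differentiable_comp _ _ _ _ (fun x => x + a) g).
    by apply: differentiableD; [exact: ex_diff|exact: differentiable_cst].
  exact: smooth_differentiable.
- move=> _ v [g sg ->]; exists ('D_v g); first exact: smooth_derive.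
  by rewrite derive_translate.
Qed.

Lemma subr_exchange (a b c d : R) : a - b - (c - d) = a - c - (b - d).
Proof. ring. Qed.

Lemma dist_le_via (a b c e : R) : `|a - c| < e -> `|b - c| < e ->
  `|a - b| <= e + e.
Proof.
move=> ac bc; rewrite -(subrKA c); apply: (le_trans (ler_normD _ _)).
by rewrite lerD// ltW// distrC.
Qed.

Local Opaque derive.

(** Two uses of the mean value theorem: first along v for the increment of f by
h w, then along w for the derivative of f along v. *)
Lemma second_difference V (f : V -> R) (x v w : V) (h : R) : smooth f -> 0 < h ->
  exists s t, [/\ 0 < s < h, 0 < t < h &
    f (x + h *: v + h *: w) - f (x + h *: v) - (f (x + h *: w) - f x) =
    h ^+ 2 * 'D_w ('D_v f) (x + s *: v + t *: w)].
Proof.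
move=> sf h0.
have sg : smooth (fun y => f (y + h *: w) - f y).
  by apply: smoothD; [exact: smooth_translate|exact: smoothN].
have [s s0h /= ->] := mean_value_line x v sg h0.
have [t t0h] := mean_value_line (x + s *: v) w (smooth_derive v sf) h0.
have -> : 'D_v (fun y : V => f (y + h *: w) - f y) (x + s *: v) =
    'D_v f (x + s *: v + h *: w) - 'D_v f (x + s *: v).
  rewrite (@deriveB _ _ _ (fun y => f (y + h *: w)) f); last 2 first.
  - exact: (smooth_derivable (smooth_translate _ sf)).
  - exact: smooth_derivable.
  by rewrite -[X in X - _]/(('D_v (fun y : V => f (y + h *: w))) (x + s *: v)) derive_translate.
move=> ->; exists s, t; split => //; ring.
Qed.

(** Schwarz's theorem: the second difference is symmetric in v and w, so both
mixed derivatives take a common value at points arbitrarily close to x. *)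
Theorem deriveC V (f : V -> R) (v w : V) : smooth f ->
  'D_v ('D_w f) = 'D_w ('D_v f).
Proof.
move=> sf; apply/funext => x.
have key e : 0 < e -> `|('D_v ('D_w f)) x - ('D_w ('D_v f)) x| <= e + e.
  move=> e0.
  have c1 := smooth_continuous (smooth_derive v (smooth_derive w sf)) (x:=x).
  have c2 := smooth_continuous (smooth_derive w (smooth_derive v sf)) (x:=x).
  move/cvgrPdist_lt: c1 => /(_ e e0) /nbhs_ballP[d1 /= d10 H1].
  move/cvgrPdist_lt: c2 => /(_ e e0) /nbhs_ballP[d2 /= d20 H2].
  pose d := Num.min d1 d2.
  have d0 : 0 < d by rewrite lt_min d10.
  (* A step h for which s v + t w stays within d of 0 whenever s, t < h. *)
  pose c := 1 + `|v| + `|w|.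
  have c0 : 0 < c by rewrite /c; have := normr_ge0 v; have := normr_ge0 w; lra.
  pose h := d / c.
  have h0 : 0 < h by rewrite divr_gt0.
  have small s t : 0 < s < h -> 0 < t < h -> `|s *: v + t *: w| < d.
    move=> /andP[s0 sh] /andP[t0 th]; apply: (le_lt_trans (ler_normD _ _)).
    rewrite !normrZ !gtr0_norm//.
    apply: (@le_lt_trans _ _ (h * (`|v| + `|w|))).
      by rewrite mulrDr lerD// ler_wpM2r// ltW.
    rewrite [ltRHS](_ : d = h * c); last by rewrite /h divfK// gt_eqF.
    by rewrite ltr_pM2l// /c; lra.
  have [s [t [s0 t0 E1]]] := second_difference x v w sf h0.
  have [t' [s' [t0' s0' E2]]] := second_difference x w v sf h0.
  have E : ('D_v ('D_w f)) (x + t' *: w + s' *: v) =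
      ('D_w ('D_v f)) (x + s *: v + t *: w).
    rewrite (addrAC x (h *: w)) subr_exchange in E2.
    by apply: (@mulfI _ (h ^+ 2)); [rewrite sqrf_eq0 gt_eqF|exact: etrans (esym E2) E1].
  have near_x r (u u' : V) : d <= r -> `|u + u'| < d -> ball x r (x + u + u').
    move=> dr ud; rewrite -ball_normE /ball_/= -addrA opprD addNKr normrN.
    exact: lt_le_trans dr.
  have dd1 : d <= d1 by rewrite ge_min lexx.
  have dd2 : d <= d2 by rewrite ge_min lexx orbT.
  have b1 := H1 _ (near_x _ (t' *: w) (s' *: v) dd1 _).
  have b2 := H2 _ (near_x _ (s *: v) (t *: w) dd2 (small _ _ s0 t0)).
  have sm : `|t' *: w + s' *: v| < d by rewrite addrC; exact: small.
  by move: (b1 sm) b2; rewrite E; exact: dist_le_via.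
apply/eqP; rewrite -subr_eq0 -normr_le0; apply/ler_addgt0Pl => e e0.
by rewrite addr0 [e]splitr; apply: key; rewrite divr_gt0.
Qed.

Lemma iterD_perm V (f : V -> R) (vs ws : seq V) : smooth f -> perm_eq vs ws ->
  iterD f vs = iterD f ws.
Proof.
move=> sf; elim: vs ws => [|v vs IH] ws; first by rewrite perm_sym => /perm_nilP ->.
move=> pe; have vws : v \in ws by rewrite -(perm_mem pe) mem_head.
case/splitPr: vws pe => w1 w2 pe.
have {}pe : perm_eq vs (w1 ++ w2).
  by rewrite -(perm_cons v) (perm_trans pe)// -cat_rcons -cats1 -catA perm_catCA.
rewrite /= (IH _ pe); elim: w1 {pe} => [//|u w1 IHw] /=.
rewrite -IHw; exact: (deriveC _ _ (smooth_iterD (w1 ++ w2) sf)).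
Qed.

End Schwarz.

Local Opaque derive.

(** * Finite-dimensional spaces and composition *)

Section Coordinates.
Context {R : realType}.
Implicit Types (V W : normedModType R).

(** Finite dimension in a form that is stable under products: a spanning family
with continuous coordinate functions. *)
Definition has_coordinates V := exists (I : finType) (b : I -> V)
  (c : I -> {linear V -> R^o}), (forall i, continuous (c i : V -> R)) /\
  forall v, v = \sum_i c i v *: b i.

Lemma has_coordinates_R : has_coordinates (R : normedModType R).
Proof.
exists unit, (fun=> 1), (fun=> idfun : {linear R -> R^o}); split => [_ x|v].
  exact: cvg_id.
by rewrite big_const /= card_unit /= addr0 [_ *: _]mulr1.
Qed.

Lemma continuous_coord n (j : 'I_n) : continuous (fun v : 'rV[R]_n => v 0 j).
Proof. exact: coord_continuous. Qed.

Definition coord_lin n (j : 'I_n) : 'rV[R]_n -> R^o := fun v => v 0 j.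
Lemma coord_lin_is_linear n j : linear (@coord_lin n j).
Proof. by move=> a u v; rewrite /coord_lin !mxE. Qed.
HB.instance Definition _ n j := GRing.isLinear.Build R 'rV[R]_n R^o *:%R
  (@coord_lin n j) (@coord_lin_is_linear n j).

Lemma has_coordinates_rV n : has_coordinates ('rV[R]_n : normedModType R).
Proof.
exists 'I_n, (fun j => delta_mx 0 j), (fun j => @coord_lin n j : {linear _ -> _}).
split => [i|v]; first exact: continuous_coord.
exact: row_sum_delta.
Qed.

Lemma has_coordinates_prod V W :
  has_coordinates V -> has_coordinates W -> has_coordinates (V * W)%type.
Proof.
move=> [I [b [c [cc bc]]]] [J [d [e [ce de]]]].
exists (I + J)%type, (fun k => match k with inl i => (b i, 0) | inr j => (0, d j) end),
  (fun k => match k with inl i => c i \o fst : {linear _ -> _}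
                       | inr j => e j \o snd : {linear _ -> _} end).
split.
  case=> [i|j] x /=; apply: continuous_comp; by [exact: cvg_fst|exact: cvg_snd|exact: cc|exact: ce].
move=> [v w]; rewrite big_sumType /=.
rewrite [RHS]surjective_pairing; congr (_, _).
  rewrite -[RHS]/((fst : {linear (V * W)%type -> V}) _) linearD !linear_sum /=.
  rewrite [X in _ + X]big1 ?addr0; last by move=> j _; exact: scaler0.
  exact: bc.
rewrite -[RHS]/((snd : {linear (V * W)%type -> W}) _) linearD !linear_sum /=.
rewrite [X in X + _]big1 ?add0r; last by move=> j _; exact: scaler0.
exact: de.
Qed.

Lemma derive_diff V (f : V -> R) x v : smooth f -> 'D_v f x = 'd f x v.
Proof. by move=> sf; rewrite deriveE//; exact: smooth_differentiable. Qed.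

Lemma derive_dirD V (f : V -> R) u v x : smooth f ->
  'D_(u + v) f x = 'D_u f x + 'D_v f x.
Proof. by move=> sf; rewrite !derive_diff// linearD. Qed.

Lemma derive_dirZ V (f : V -> R) a v x : smooth f ->
  'D_(a *: v) f x = a * 'D_v f x.
Proof. by move=> sf; rewrite !derive_diff// linearZ. Qed.

Lemma derive_dir_sum V (f : V -> R) (I : Type) (r : seq I) (v : I -> V) x :
  smooth f -> 'D_(\sum_(i <- r) v i) f x = \sum_(i <- r) 'D_(v i) f x.
Proof.
move=> sf; rewrite derive_diff// linear_sum; apply: eq_bigr => i _.
by rewrite derive_diff.
Qed.

Lemma derive_comp V W (f : W -> R) (g : V -> W) x v : smooth f ->
  differentiable g x -> 'D_v (f \o g) x = 'D_('D_v g x) f (g x).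
Proof.
move=> sf dg; have df : differentiable f (g x) by exact: smooth_differentiable.
rewrite deriveE; last exact: differentiable_comp.
by rewrite diff_comp//= (deriveE _ df) deriveE.
Qed.

(** Smoothness of a vector valued map is tested on continuous linear forms, so
that only the notion for real valued functions is needed. *)
Definition smooth_map V W (g : V -> W) :=
  forall l : {linear W -> R^o}, continuous (l : W -> R) ->
    smooth (fun v => l (g v) : R).

Lemma smooth_map_differentiable V W (g : V -> W) x : has_coordinates W ->
  smooth_map g -> differentiable g x.
Proof.
move=> [I [b [c [cc bc]]]] sg.
have -> : g = (fun x => \sum_i c i (g x) *: b i).
  by apply/funext => y; exact: bc.
elim: (index_enum I) => [|i r IH].
  have -> : (fun x => \sum_(i <- [::]) c i (g x) *: b i) = cst 0.
    by apply/funext => y; rewrite big_nil.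
  exact: differentiable_cst.
have -> : (fun x => \sum_(i <- i :: r) c i (g x) *: b i) =
    (fun x => c i (g x) *: b i) + (fun x => \sum_(i <- r) c i (g x) *: b i).
  by apply/funext => y; rewrite big_cons.
apply: differentiableD => //; apply: differentiableZl.
exact: (smooth_differentiable _ (sg _ (cc i))).
Qed.

(** The class to which [smooth_closure] is applied for composition: by the chain
rule, the derivative of f \o g is a sum of products of a smooth function (the
derivative of a coordinate of g) and a function composed with g. *)
Inductive composite_sum V W (g : V -> W) : (V -> R) -> Prop :=
| composite_sum_mul a f : smooth a -> smooth f ->
    composite_sum g (fun x => a x * f (g x))
| composite_sum_add h1 h2 : composite_sum g h1 -> composite_sum g h2 ->
    composite_sum g (fun x => h1 x + h2 x).

Lemma composite_sum_differentiable V W (g : V -> W) h x :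
  (forall x, differentiable g x) -> composite_sum g h -> differentiable h x.
Proof.
move=> dg; elim=> {h} [a f sa sf|h1 h2 _ IH1 _ IH2]; last exact: differentiableD.
apply: differentiableM; first exact: smooth_differentiable.
by apply: (@differentiable_comp _ _ _ _ g f) => //; exact: smooth_differentiable.
Qed.

Lemma composite_sum_big V W (g : V -> W) (I : Type) (r : seq I)
    (a : I -> V -> R) (f : I -> W -> R) :
  (forall i, smooth (a i)) -> (forall i, smooth (f i)) ->
  composite_sum g (fun x => \sum_(i <- r) a i x * f i (g x)).
Proof.
move=> sa sf; elim: r => [|i r IH].
  have -> : (fun x => \sum_(i <- [::]) a i x * f i (g x)) = (fun x => 0 * 0).
    by apply/funext => x; rewrite big_nil mulr0.
  by apply: (@composite_sum_mul _ _ _ (fun=> 0) (fun=> 0)); exact: smooth_cst.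
have -> : (fun x => \sum_(i <- i :: r) a i x * f i (g x)) =
    (fun x => a i x * f i (g x) + \sum_(i <- r) a i x * f i (g x)).
  by apply/funext => x; rewrite big_cons.
by apply: composite_sum_add => //; exact: composite_sum_mul.
Qed.

Lemma smooth_comp V W (f : W -> R) (g : V -> W) : has_coordinates W ->
  smooth f -> smooth_map g -> smooth (f \o g).
Proof.
move=> hW sf sg; have dg x := smooth_map_differentiable x hW sg.
have [I [b [c [cc bc]]]] := hW.
apply: (@smooth_closure _ _ (composite_sum g)).
- by move=> h x; exact: composite_sum_differentiable.
- move=> h v; elim=> {h} [a f1 sa sf1|h1 h2 p1 IH1 p2 IH2]; last first.
    have -> : 'D_v (fun x => h1 x + h2 x) = (fun x => 'D_v h1 x + 'D_v h2 x).
      apply/funext => x; rewrite (@deriveD _ _ _ h1 h2)//;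
        exact/diff_derivable/(composite_sum_differentiable _ dg).
    exact: composite_sum_add.
  have -> : 'D_v (fun x => a x * f1 (g x)) = (fun x => 'D_v a x * f1 (g x) +
      \sum_i (a x * 'D_v (fun y => c i (g y) : R) x) * 'D_(b i) f1 (g x)).
    apply/funext => x; rewrite (@deriveM _ _ a (f1 \o g)) /=; last 2 first.
    - exact: smooth_derivable.
    - apply/diff_derivable/differentiable_comp => //.
      exact: smooth_differentiable.
    rewrite addrC; congr (_ + _); first by rewrite /GRing.scale/= mulrC.
    rewrite /GRing.scale/= derive_comp//.
    have -> : 'D_v g x = \sum_i 'D_v (fun y => c i (g y) : R) x *: b i.
      rewrite [LHS]bc; apply: eq_bigr => i _; congr (_ *: _).
      have sc : smooth (c i : W -> R) by apply: smooth_lin; exact: cc.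
      rewrite -[RHS]/('D_v ((c i : W -> R) \o g) x) derive_comp//.
      by rewrite -[RHS]/(('D_('D_v g x) (c i : W -> R)) (g x)) derive_linE//; exact: cc.
    rewrite derive_dir_sum// mulr_sumr; apply: eq_bigr => i _.
    by rewrite derive_dirZ// mulrA.
  apply: composite_sum_add.
    by apply: (@composite_sum_mul _ _ _ ('D_v a)) => //; exact: smooth_derive.
  apply: (@composite_sum_big _ _ _ _ _
    (fun i x => a x * 'D_v (fun y => c i (g y) : R) x) (fun i => 'D_(b i) f1)) => i;
    last exact: smooth_derive.
  by apply: smoothM => //; apply/smooth_derive/sg/cc.
- have -> : f \o g = (fun x => 1 * f (g x)) by apply/funext => x; rewrite mul1r.
  by apply: (@composite_sum_mul _ _ _ (fun=> 1)) => //; exact: smooth_cst.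
Qed.

End Coordinates.

(** * Integration of compactly supported functions on the line *)

Section LineIntegral.
Context {R : realType}.
Local Notation mu := (@lebesgue_measure R).
Implicit Types f g F : R -> R.

Definition vanishes_beyond (B : R) f := forall t, B < `|t| -> f t = 0.

Lemma vanishes_beyond_le (B B' : R) f : B <= B' -> vanishes_beyond B f ->
  vanishes_beyond B' f.
Proof. by move=> BB' f0 t Bt; apply: f0; exact: le_lt_trans Bt. Qed.

Lemma integral_truncate (B : R) f : vanishes_beyond B f ->
  \int[mu]_t f t = \int[mu]_(t in `[- B, B]) f t.
Proof.
move=> f0; rewrite [RHS]Rintegral_mkcond; apply: eq_Rintegral => t _.
rewrite patchE; case: ifPn => // /negP tB; apply: f0; rewrite ltNge; apply/negP.
by move=> tB'; apply: tB; rewrite inE/= in_itv/= -ler_norml.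
Qed.

Lemma integrable_segment (a b : R) f : continuous f ->
  mu.-integrable `[a, b] (EFin \o f).
Proof.
move=> cf; apply: continuous_compact_integrable; first exact: segment_compact.
exact: continuous_subspaceT.
Qed.

Lemma line_integral_linear (a : R) f g B B' : continuous f -> continuous g ->
  vanishes_beyond B f -> vanishes_beyond B' g ->
  \int[mu]_t (a * f t + g t) = a * (\int[mu]_t f t) + \int[mu]_t g t.
Proof.
move=> cf cg f0 g0; pose M := Num.max B B'.
have {}f0 : vanishes_beyond M f.
  by apply: vanishes_beyond_le f0; rewrite le_max lexx.
have {}g0 : vanishes_beyond M g.
  by apply: vanishes_beyond_le g0; rewrite le_max lexx orbT.
rewrite !(@integral_truncate M)//; last first.
  by move=> t Mt; rewrite f0// g0// mulr0 addr0.
rewrite RintegralD//; last 2 first.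
- apply: (@integrable_segment _ _ (fun t => a * f t)) => t.
  by apply: cvgM; [exact: cvg_cst|exact: cf].
- exact: integrable_segment.
by rewrite RintegralZl//; exact: integrable_segment.
Qed.

Lemma continuous_lincomb (I : Type) (r : seq I) (a : I -> R) (f : I -> R -> R) :
  (forall i, continuous (f i)) -> continuous (fun t => \sum_(i <- r) a i * f i t).
Proof.
move=> cf; elim: r => [|i r IH].
  rewrite (_ : (fun _ => _) = cst 0); last by apply/funext => t; rewrite big_nil.
  by move=> t; exact: cvg_cst.
rewrite (_ : (fun _ => _) = (fun t => a i * f i t + \sum_(i <- r) a i * f i t)).
  move=> t; apply: cvgD; last exact: IH.
  by apply: cvgM; [exact: cvg_cst|exact: cf].
by apply/funext => t; rewrite big_cons.
Qed.

Lemma line_integral_sum (I : Type) (r : seq I) (a : I -> R) (f : I -> R -> R) B :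
  (forall i, continuous (f i)) -> (forall i, vanishes_beyond B (f i)) ->
  \int[mu]_t (\sum_(i <- r) a i * f i t) =
  \sum_(i <- r) a i * (\int[mu]_t f i t).
Proof.
move=> cf f0; elim: r => [|i r IH].
  rewrite big_nil -[RHS](mul0r (fine (mu setT))) -Rintegral_cst//.
  by apply: eq_Rintegral => t _; rewrite big_nil.
rewrite big_cons -IH -(@line_integral_linear _ _ _ B B)//.
- by apply: eq_Rintegral => t _; rewrite big_cons.
- exact: continuous_lincomb.
- by move=> t Bt; rewrite big1// => j _; rewrite f0// mulr0.
Qed.

Lemma line_integral_bound f (B e : R) : 0 <= B -> 0 <= e -> continuous f ->
  vanishes_beyond B f -> (forall t, `|t| <= B -> `|f t| <= e) ->
  `|\int[mu]_t f t| <= e * (2 * B).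
Proof.
move=> B0 e0 cf f0 fe; rewrite (integral_truncate f0).
apply: (le_trans (le_normr_Rintegral _ (integrable_segment _ _ cf))) => //.
have -> : e * (2 * B) = \int[mu]_(t in `[- B, B]) e.
  rewrite Rintegral_cst//= lebesgue_measure_itv/= lte_fin.
  case: ifPn => BB /=; first by rewrite opprK -mulr2n mulr_natl.
  have -> : B = 0 by move: BB; rewrite -leNgt => BB; apply/eqP; lra.
  by rewrite !mulr0.
apply: le_Rintegral => //.
- apply: (@integrable_segment _ _ (fun t => `|f t|)) => t.
  by apply: cvg_norm; exact: cf.
- apply: (@integrable_segment _ _ (fun t => e)) => t; exact: cvg_cst.
- by move=> t /=; rewrite in_itv/= -ler_norml; exact: fe.
Qed.

(** The fundamental theorem of calculus on a segment that contains the supports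
in its interior, so that both boundary terms vanish. *)
Lemma line_integral_derivative F f (B : R) : continuous f ->
  (forall t : R, is_derive t (1 : R) F (f t)) ->
  vanishes_beyond B F -> vanishes_beyond B f -> \int[mu]_t f t = 0.
Proof.
move=> cf dF F0 f0; pose M := `|B| + 1.
have BM : B < M by rewrite ltr_pwDr// ler_norm.
have M0 : 0 < M by rewrite ltr_wpDl.
rewrite (@integral_truncate M); last exact: vanishes_beyond_le (ltW BM) f0.
rewrite /Rintegral (@continuous_FTC2 _ f F (- M) M).
- have FM : F M = 0 by apply: F0; rewrite gtr0_norm.
  have FNM : F (- M) = 0 by apply: F0; rewrite normrN gtr0_norm.
  by rewrite FM FNM subee.
- lra.
- exact: continuous_subspaceT.
- have cF : continuous F.
    by move=> t; apply/differentiable_continuous/derivable1_diffP; case: (dF t).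
  split; [by move=> t _; case: (dF t)|..].
    by apply: cvg_at_right_filter; exact: cF.
  by apply: cvg_at_left_filter; exact: cF.
- by move=> t _; rewrite derive1E; case: (dF t).
Qed.

End LineIntegral.

(** * Differentiation under an integral over the line *)

Section Parametric.
Context {R : realType}.
Local Notation mu := (@lebesgue_measure R).
Implicit Types (V W : normedModType R).

(** The support condition that makes an integral over the second variable a
locally uniform integral over a bounded set.  A bound on balls, instead of on
neighbourhoods, is easier to carry through iterated integrals. *)
Definition fiber_bounded V W (g : V * W -> R) := forall r : R, exists B : R,
  forall v w, `|v| < r -> B < `|w| -> g (v, w) = 0.

Lemma derive_vanish V W (g : V * W -> R) u (r B : R) :
  (forall v w, `|v| < r -> B < `|w| -> g (v, w) = 0) ->
  forall v w, `|v| < r -> B < `|w| -> 'D_u g (v, w) = 0.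
Proof.
move=> gB v w vr wB; rewrite (@near_eq_derive _ _ _ g (cst 0)) ?derive_cst//.
have nv : nbhs (v, w) [set z : V * W | `|z.1| < r].
  apply: open_nbhs_nbhs; split => //.
  apply: (@open_comp _ _ (fun z : V * W => `|z.1|) [set s | s < r]); last exact: open_lt.
  by move=> z _; apply: continuous_comp; [exact: cvg_fst|exact: norm_continuous].
have nw : nbhs (v, w) [set z : V * W | B < `|z.2|].
  apply: open_nbhs_nbhs; split => //.
  apply: (@open_comp _ _ (fun z : V * W => `|z.2|) [set s | B < s]); last exact: open_gt.
  by move=> z _; apply: continuous_comp; [exact: cvg_snd|exact: norm_continuous].
near=> z; rewrite [z]surjective_pairing; apply: gB; near: z.
  exact: nv.
exact: nw.
Unshelve. all: by end_near. Qed.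

Lemma fiber_bounded_derive V W (g : V * W -> R) u :
  fiber_bounded g -> fiber_bounded ('D_u g).
Proof. by move=> g0 r; have [B gB] := g0 r; exists B; exact: derive_vanish. Qed.

Lemma continuous_pair (T U U' : topologicalType) (f : T -> U) (g : T -> U') :
  continuous f -> continuous g -> continuous (fun x => (f x, g x)).
Proof. by move=> cf cg x; exact: (cvg_pair (cf x) (cg x)). Qed.

(** The tube lemma: continuity is uniform in t when t ranges over a compact set. *)
Lemma uniform_on_segment V (f : V * R -> R) v (B e : R) : continuous f -> 0 < e ->
  \forall h \near (0 : V), forall t, `|t| <= B -> `|f (v + h, t) - f (v, t)| < e.
Proof.
move=> cf e0.
have /compact_near_coveringP := @segment_compact R (- B) B.
move=> /(_ V (nbhs (0 : V)) (fun h t => `|f (v + h, t) - f (v, t)| < e) _) H.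
have {}H : \forall h \near (0 : V), `[- B, B] `<=` (fun t => `|f (v + h, t) - f (v, t)| < e).
  apply: H => t _.
  pose G (z : R * V) : R := f (v + z.2, z.1) - f (v, z.1).
  have c1 : continuous (fun z : R * V => f (v + z.2, z.1)).
    have c : continuous (fun z : R * V => (v + z.2, z.1)).
      apply: continuous_pair => z; last exact: cvg_fst.
      by apply: cvgD; [exact: cvg_cst|exact: cvg_snd].
    by move=> z; apply: (continuous_comp (c z)); exact: cf.
  have c2 : continuous (fun z : R * V => f (v, z.1)).
    have c : continuous (fun z : R * V => (v, z.1)).
      by apply: continuous_pair => z; [exact: cvg_cst|exact: cvg_fst].
    by move=> z; apply: (continuous_comp (c z)); exact: cf.
  have cG : G z @[z --> (t, 0 : V)] --> G (t, 0).
    by apply: cvgB; [exact: c1|exact: c2].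
  move: cG; rewrite {2}/G /= addr0 subrr.
  move=> /cvgrPdist_lt/(_ e e0).
  by apply: filterS => -[t' h]; rewrite sub0r normrN.
by apply: filterS H => h H t tB; apply: H; rewrite /= in_itv/= -ler_norml.
Qed.

Lemma continuous_slice V W (g : V * W -> R) v : continuous g ->
  continuous (fun w => g (v, w)).
Proof.
move=> cg; have c : continuous (fun w : W => (v, w)).
  by apply: continuous_pair => w; [exact: cvg_cst|exact: cvg_id].
by move=> w; apply: (continuous_comp (c w)); exact: cg.
Qed.

Lemma smooth_slice_continuous V W (g : V * W -> R) v : smooth g ->
  continuous (fun w => g (v, w)).
Proof. by move=> sg; apply/continuous_slice/smooth_continuous. Qed.

Definition param_integral V (g : V * R -> R) (v : V) : R := \int[mu]_t g (v, t).

Lemma derive_fst_coords V W (g : V * W -> R) (I : Type) (r : seq I)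
    (a : I -> R) (b : I -> V) p : smooth g ->
  'D_(\sum_(i <- r) a i *: b i, 0 : W) g p =
  \sum_(i <- r) a i * 'D_(b i, 0 : W) g p.
Proof.
move=> sg; elim: r => [|i r IH]; first by rewrite !big_nil derive0.
rewrite !big_cons -IH -derive_dirZ// -derive_dirD//.
have -> : (a i *: b i + \sum_(j <- r) a j *: b j, 0 : W) =
    a i *: (b i, 0 : W) + (\sum_(j <- r) a j *: b j, 0) :> (V * W)%type.
  by congr (_, _); rewrite /= scaler0 addr0.
by [].
Qed.

Section Frechet.
Context (V : normedModType R) (g : V * R -> R).
Hypotheses (sg : smooth g) (fg : fiber_bounded g).

(** The candidate differential is u |-> \int D_(u,0) g, which is linear and
continuous because it is expressed in coordinates.  By the mean value theorem
the remainder of the expansion of g (., t) is a combination of increments of the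
partial derivatives, which are small uniformly in t by [uniform_on_segment]. *)
Lemma param_integral_differential : has_coordinates V -> forall v : V,
  differentiable (param_integral g) v /\
  forall u, 'D_u (param_integral g) v = param_integral ('D_(u, 0 : R) g) v.
Proof.
move=> [I [b [c [cc bc]]]] v.
have [B0 gB0] := fg (`|v| + 1); pose B := `|B0|.
have B_ge0 : 0 <= B by exact: normr_ge0.
have gB w t : `|w| < `|v| + 1 -> B < `|t| -> g (w, t) = 0.
  by move=> wr Bt; apply: gB0 => //; apply: le_lt_trans Bt; exact: ler_norm.
have vv : `|v| < `|v| + 1 by rewrite ltrDl.
pose D i : V * R -> R := 'D_(b i, 0 : R) g.
have sD i : smooth (D i) by exact: smooth_derive.
have DB i : vanishes_beyond B (fun t => D i (v, t)).
  by move=> t Bt; exact: derive_vanish gB _ _ vv Bt.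
have DE u p : 'D_(u, 0 : R) g p = \sum_i c i u * D i p.
  by rewrite {1}[u]bc derive_fst_coords.
pose L (u : V) : R^o := \sum_i c i u * \int[mu]_t D i (v, t).
have LE u : L u = \int[mu]_t (\sum_i c i u * D i (v, t)).
  rewrite (@line_integral_sum _ _ _ _ (fun i t => D i (v, t)) B)// => i.
  exact: smooth_slice_continuous.
have Llin : linear L.
  move=> a u w; rewrite /L scaler_sumr -big_split /=; apply: eq_bigr => i _.
  by rewrite linearP /= mulrDl /GRing.scale/= mulrA.
pose Lp : {linear V -> R^o} := HB.pack L (GRing.isLinear.Build R V R^o *:%R L Llin).
have cL : continuous (Lp : V -> R).
  apply: smooth_continuous; apply: (@smooth_sum _ _ _ _
    (fun i u => c i u * \int[mu]_t D i (v, t))) => i.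
  by apply: smoothM; [apply: smooth_lin; exact: cc|exact: smooth_cst].
have expansion : param_integral g \o shift v =
    cst (param_integral g v) + (Lp : V -> R) +o_ 0 id.
  apply/eqaddoP => _ /posnumP[e].
  pose k i := xget 0 [set k : R | 0 < k /\ forall u, `|c i u| <= k * `|u|].
  have kP i : 0 < k i /\ forall u, `|c i u| <= k i * `|u|.
    have [k0 k00 k0P] := linear_lipschitz (cc i).
    by rewrite /k; case: xgetP => [y -> //|/(_ k0)[]].
  pose C := \sum_i k i.
  have C0 : 0 <= C by apply: sumr_ge0 => i _; apply/ltW; case: (kP i).
  (* C bounds the coordinates and 2 B is the length of the segment; adding 1 avoids
     a division by 0. *)
  pose e' := e%:num / (C * (2 * B) + 1).
  have D0 : 0 < C * (2 * B) + 1 by rewrite ltr_wpDl// !mulr_ge0.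
  have e'0 : 0 < e' by rewrite divr_gt0.
  have : \forall h \near (0 : V), forall i t, `|t| <= B ->
      `|D i (v + h, t) - D i (v, t)| < e'.
    apply: filter_forall => i; apply: uniform_on_segment => //.
    exact: smooth_continuous.
  move=> /nbhs_ballP[d0 /= d00 Hd0].
  pose d := Num.min d0 1; have dgt0 : 0 < d by rewrite lt_min d00 ltr01.
  near=> h.
  have hd : `|h| < d by near: h; exact: nbhs0_lt.
  have hd0 : `|h| < d0 by rewrite (lt_le_trans hd)// ge_min lexx.
  have h1 : `|h| < 1 by rewrite (lt_le_trans hd)// ge_min lexx orbT.
  have vh : `|h + v| < `|v| + 1.
    by rewrite addrC (le_lt_trans (ler_normD _ _))// ltrD2l.
  suff : `|param_integral g (h + v) - (param_integral g v + L h)| <= e%:num * `|h| by [].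
  have slice i : continuous (fun t => D i (v, t)) by exact: smooth_slice_continuous.
  pose S t := \sum_i c i h * D i (v, t).
  have cS : continuous S by exact: continuous_lincomb.
  have S0 : vanishes_beyond B S.
    by move=> t Bt; rewrite /S big1// => i _; rewrite DB// mulr0.
  have gv0 : vanishes_beyond B (fun t => g (v, t)) by move=> t; exact: gB.
  have ghv0 : vanishes_beyond B (fun t => g (h + v, t)) by move=> t; exact: gB.
  pose r1 t := -1 * g (v, t) + g (h + v, t).
  have cr1 : continuous r1.
    move=> t; apply: cvgD; last exact: smooth_slice_continuous.
    by apply: cvgM; [exact: cvg_cst|exact: smooth_slice_continuous].
  have r10 : vanishes_beyond B r1.
    by move=> t Bt; rewrite /r1 gv0// ghv0// mulr0 addr0.
  have -> : param_integral g (h + v) - (param_integral g v + L h) =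
      \int[mu]_t (-1 * S t + r1 t).
    rewrite (line_integral_linear _ cS cr1 S0 r10) /r1.
    rewrite (@line_integral_linear _ _ (fun t => g (v, t)) _ B B)//; last 2 first.
    - exact: smooth_slice_continuous.
    - exact: smooth_slice_continuous.
    rewrite LE /param_integral -/S; ring.
  apply: (@le_trans _ _ (e' * C * `|h| * (2 * B))); last first.
    have -> : e' * C * `|h| * (2 * B) = e' * (C * (2 * B)) * `|h| by ring.
    rewrite ler_wpM2r// /e' -mulrA ler_piMr// mulrC ler_pdivrMr// mul1r.
    by rewrite lerDl.
  apply: line_integral_bound => //.
  - by apply: mulr_ge0 => //; apply: mulr_ge0 => //; exact: ltW.
  - move=> t; apply: cvgD; last exact: cr1.
    by apply: cvgM; [exact: cvg_cst|exact: cS].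
  - by move=> t Bt; rewrite S0// r10// mulr0 addr0.
  move=> t tB.
  have [s /andP[s0 s1]] := mean_value_line (v, t) (h, 0 : R) sg ltr01.
  rewrite scale1r mul1r DE.
  have -> : (v, t) + (h, 0) = (h + v, t) by congr (_, _); rewrite /= ?addr0// addrC.
  have -> : (v, t) + s *: (h, 0 : R) = (v + s *: h, t).
    by congr (_, _); rewrite /= scaler0 addr0.
  move=> E; have {E} -> : -1 * S t + r1 t =
      \sum_i c i h * (D i (v + s *: h, t) - D i (v, t)).
    have -> : -1 * S t + r1 t = g (h + v, t) - g (v, t) - S t by rewrite /r1; ring.
    rewrite E /S -sumrB.
    by apply: eq_bigr => i _; rewrite mulrBr.
  apply: (le_trans (ler_norm_sum _ _ _)).
  rewrite /C mulr_sumr mulr_suml; apply: ler_sum => i _.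
  have [_ kb] := kP i.
  have bs : ball (0 : V) d0 (s *: h).
    rewrite -ball_normE /= sub0r normrN normrZ gtr0_norm//.
    by apply: le_lt_trans hd0; rewrite ler_piMl// ltW.
  have -> : e' * k i * `|h| = (k i * `|h|) * e' by ring.
  rewrite normrM; apply: ler_pM; [by []|by []|exact: kb|].
  by have := Hd0 _ bs i t tB => /ltW.
have dG := diff_unique cL expansion.
have dfG : differentiable (param_integral g) v.
  by apply/diff_locallyP; rewrite dG.
split => // u; rewrite deriveE// dG -[LHS]/(L u) LE.
by apply: eq_Rintegral => t _; rewrite DE.
Unshelve. all: by end_near. Qed.

End Frechet.

End Parametric.

(** * Consequences, and linear changes of variables *)

Section ParametricRn.
Context {R : realType}.
Implicit Types (V W : normedModType R).

Lemma fiber_bounded_integral_vanish V (g : V * R -> R) v :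
  fiber_bounded g -> exists B, vanishes_beyond B (fun t => g (v, t)).
Proof.
by move=> fg; have [B gB] := fg (`|v| + 1); exists B => t; apply: gB; rewrite ltrDl.
Qed.

Lemma param_integral_smooth V (g : V * R -> R) : has_coordinates V ->
  smooth g -> fiber_bounded g -> smooth (param_integral g).
Proof.
move=> hV sg fg.
apply: (@smooth_closure _ _ (fun h => exists g, [/\ smooth g, fiber_bounded g &
    h = param_integral g])); last by exists g.
- by move=> _ x [h [sh fh ->]]; case: (param_integral_differential sh fh hV x).
- move=> _ v [h [sh fh ->]]; exists ('D_(v, 0) h).
  split; [exact: smooth_derive|exact: fiber_bounded_derive|].
  by apply/funext => x; case: (param_integral_differential sh fh hV x).
Qed.

Lemma param_integral_derive V (g : V * R -> R) u : has_coordinates V ->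
  smooth g -> fiber_bounded g ->
  'D_u (param_integral g) = param_integral ('D_(u, 0 : R) g).
Proof.
move=> hV sh fh.
by apply/funext => x; case: (param_integral_differential sh fh hV x).
Qed.

Lemma param_integral_linear V (a : R) (g h : V * R -> R) : smooth g -> smooth h ->
  fiber_bounded g -> fiber_bounded h ->
  param_integral (fun z => a * g z + h z) =
  (fun v => a * param_integral g v + param_integral h v).
Proof.
move=> sg sh fg fh; apply/funext => v.
have [B gB] := fiber_bounded_integral_vanish v fg.
have [B' hB] := fiber_bounded_integral_vanish v fh.
by apply: line_integral_linear gB hB; exact: smooth_slice_continuous.
Qed.

Lemma param_integral_derive_fiber V (g : V * R -> R) : smooth g -> fiber_bounded g ->
  param_integral ('D_(0 : V, 1 : R) g) = (fun=> 0).
Proof.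
move=> sg fg; apply/funext => v.
have [B gB] := fg (`|v| + 1).
have vv : `|v| < `|v| + 1 by rewrite ltrDl.
apply: (@line_integral_derivative _ (fun t => g (v, t))
  (fun t : R => 'D_(0 : V, 1 : R) g (v, t)) B).
- exact: (smooth_slice_continuous (smooth_derive (0 : V, 1 : R) sg)).
- move=> t; have := is_derive_line (v, 0 : R) (0 : V, 1 : R) t sg.
  have E s : (v, 0 : R) + s *: (0 : V, 1 : R) = (v, s).
    by congr (_, _); rewrite /= ?scaler0 ?addr0// add0r [_ *: _]mulr1.
  rewrite E; have -> : (fun s : R => g ((v, 0 : R) + s *: (0 : V, 1 : R))) =
      (fun s => g (v, s)) by apply/funext => s; rewrite E.
  by [].
- by move=> t; exact: gB.
- by move=> t; exact: (derive_vanish _ gB).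
Qed.

Lemma entry_le_norm n (v : 'rV[R]_n) j : `|v 0 j| <= `|v|.
Proof. by rewrite [leRHS]/Num.norm /= mx_normrE; apply/bigmax_geP; right => /=; exists (0, j). Qed.

Lemma norm_le_entries n (v : 'rV[R]_n) e : 0 <= e -> (forall j, `|v 0 j| <= e) ->
  `|v| <= e.
Proof.
move=> e0 H; rewrite [leLHS]/Num.norm /= mx_normrE; apply: bigmax_le => // -[i j] _ /=.
by rewrite ord1.
Qed.

Lemma lipschitz_linear_continuous V W (f : {linear V -> W}) (k : R) :
  (forall x, `|f x| <= k * `|x|) -> continuous f.
Proof.
move=> fk; apply: bounded_linear_continuous; apply/linear_boundedP.
near=> r => x; apply: (le_trans (fk x)); rewrite ler_wpM2r//.
Unshelve. all: by end_near. Qed.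

(** For a linear map the chain rule has constant coefficients, so no coordinates
of the target enter, unlike in [smooth_comp]. *)
Lemma derive_comp_lin V W (A : {linear V -> W}) (f : W -> R) v : continuous A ->
  smooth f -> 'D_v (f \o A) = 'D_(A v) f \o A.
Proof.
move=> cA sf; apply/funext => x; have dA := linear_differentiable x cA.
rewrite derive_comp//=; suff -> : 'D_v A x = A v by [].
by rewrite (deriveE _ dA) diff_lin.
Qed.

Lemma smooth_comp_lin V W (A : {linear V -> W}) (f : W -> R) : continuous A ->
  smooth f -> smooth (f \o A).
Proof.
move=> cA sf.
apply: (@smooth_closure _ _ (fun h => exists2 f, smooth f & h = f \o A)); last by exists f.
- move=> _ x [h sh ->]; apply: differentiable_comp; first exact: linear_differentiable.
  exact: smooth_differentiable.
- move=> _ v [h sh ->]; exists ('D_(A v) h); first exact: smooth_derive.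
  by rewrite derive_comp_lin.
Qed.

End ParametricRn.

(** * Iterated integrals over R^n with parameters *)

Section IntegralRn.
Context {R : realType}.
Local Notation mu := (@lebesgue_measure R).
Implicit Types (V W : normedModType R).

Definition param_integral_Rn V n (g : V * 'rV[R]_n -> R) (v : V) : R :=
  integral_Rn (fun y => g (v, y)).

Lemma integral_Rn0 n : integral_Rn (fun _ : 'rV[R]_n => 0 : R) = 0.
Proof.
elim: n => [//|n IH] /=.
rewrite -[RHS](mul0r (fine (mu setT))) -Rintegral_cst//.
by apply: eq_Rintegral => t _; exact: IH.
Qed.

Section Unroll.
Context (V : normedModType R) (n : nat).

(** Moves the first coordinate of the integration variable among the parameters;
this is what makes an induction on the dimension follow the definition of the
iterated integral. *)
Definition unroll (z : (V * R) * 'rV[R]_n) : V * 'rV[R]_n.+1 :=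
  (z.1.1, row_mx z.1.2%:M z.2 : 'rV_(1 + n)).

Lemma unroll_is_linear : linear unroll.
Proof.
move=> a [[v t] y] [[v' t'] y']; congr (_, _) => /=.
rewrite -[RHS]/(a *: (row_mx t%:M y : 'M[R]_(1, 1 + n)) + row_mx t'%:M y').
by rewrite scale_row_mx add_row_mx scale_scalar_mx -raddfD.
Qed.
HB.instance Definition _ := GRing.isLinear.Build R
  ((V * R) * 'rV[R]_n)%type (V * 'rV[R]_n.+1)%type *:%R unroll unroll_is_linear.

Lemma unroll_continuous : continuous unroll.
Proof.
apply: (@lipschitz_linear_continuous _ _ _ unroll 1) => -[[v t] y].
rewrite mul1r /unroll /= !prod_normE /=.
rewrite ge_max; apply/andP; split; first by rewrite !le_max lexx.
apply: norm_le_entries; first by rewrite !le_max normr_ge0.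
move=> j; rewrite mxE; case: splitP => k _.
  by rewrite !ord1 mxE eqxx mulr1n !le_max lexx orbT.
by rewrite !le_max entry_le_norm orbT.
Qed.

Lemma norm_unroll_head (t : R) (y : 'rV[R]_n) :
  `|t| <= `|row_mx t%:M y : 'rV_n.+1|.
Proof.
have := entry_le_norm (row_mx t%:M y : 'rV_(1 + n)) (lshift n 0).
by rewrite row_mxEl mxE eqxx mulr1n.
Qed.

Lemma norm_unroll_tail (t : R) (y : 'rV[R]_n) :
  `|y| <= `|row_mx t%:M y : 'rV_n.+1|.
Proof.
apply: norm_le_entries => // j.
have := entry_le_norm (row_mx t%:M y : 'rV_(1 + n)) (rshift 1 j).
by rewrite row_mxEr.
Qed.

Context (g : V * 'rV[R]_n.+1 -> R).

Lemma smooth_unroll : smooth g -> smooth (g \o unroll).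
Proof. exact/smooth_comp_lin/unroll_continuous. Qed.

Lemma fiber_bounded_unroll : fiber_bounded g -> fiber_bounded (g \o unroll).
Proof.
move=> fg r; have [B gB] := fg r; exists B => -[v t] y vr By; apply: gB => /=.
  by apply: le_lt_trans vr; rewrite prod_normE le_max lexx.
exact: lt_le_trans (norm_unroll_tail _ _).
Qed.

Lemma fiber_bounded_integral : fiber_bounded g ->
  fiber_bounded (param_integral_Rn (g \o unroll)).
Proof.
move=> fg r; have [B gB] := fg r; exists B => v t vr Bt.
rewrite /param_integral_Rn -[RHS](integral_Rn0 n); congr integral_Rn.
apply/funext => y /=; apply: gB => //; exact: lt_le_trans (norm_unroll_head _ _).
Qed.

Lemma derive_unroll z : smooth g ->
  'D_(unroll z) g \o unroll = 'D_z (g \o unroll).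
Proof. by move=> sg; rewrite (derive_comp_lin _ unroll_continuous sg). Qed.

End Unroll.

(** Induction on the dimension, for all parameter spaces at once: after
[unroll], the inner integral is a smooth function of the enlarged parameter,
to which the one-dimensional result applies. *)
Theorem param_integral_Rn_smooth n V (g : V * 'rV[R]_n -> R) : has_coordinates V ->
  smooth g -> fiber_bounded g -> smooth (param_integral_Rn g) /\
  forall u, 'D_u (param_integral_Rn g) = param_integral_Rn ('D_(u, 0) g).
Proof.
elim: n V g => [|n IH] V g hV sg fg.
  pose A (v : V) : V * 'rV[R]_0 := (v, 0).
  have Alin : linear A by move=> a u v; congr (_, _); rewrite /= scaler0 addr0.
  pose Ap : {linear V -> (V * 'rV[R]_0)%type} :=
    HB.pack A (GRing.isLinear.Build R V (V * 'rV[R]_0)%type *:%R A Alin).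
  have cA : continuous Ap by apply: continuous_pair => v; [exact: cvg_id|exact: cvg_cst].
  split; first exact: (smooth_comp_lin cA sg).
  by move=> u; exact: (derive_comp_lin u cA sg).
have sg' := smooth_unroll sg; have fg' := fiber_bounded_unroll fg.
have hVR : has_coordinates (V * R)%type.
  by apply: has_coordinates_prod => //; exact: has_coordinates_R.
have [sJ dJ] := IH _ _ hVR sg' fg'.
have fJ := fiber_bounded_integral fg.
split; first exact: (param_integral_smooth hV sJ fJ).
move=> u; rewrite -[LHS]/('D_u (param_integral (param_integral_Rn (g \o @unroll V n)))).
rewrite (param_integral_derive u hV sJ fJ) (dJ (u, 0)).
have uE : unroll ((u, 0 : R), 0 : 'rV_n) = (u, 0).
  by congr (_, _); rewrite /= raddf0 row_mx0.
by rewrite -(derive_unroll _ sg) uE.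
Qed.

Lemma param_integral_Rn_linear n V (a : R) (g h : V * 'rV[R]_n -> R) :
  has_coordinates V -> smooth g -> smooth h ->
  fiber_bounded g -> fiber_bounded h ->
  param_integral_Rn (fun z => a * g z + h z) =
  (fun v => a * param_integral_Rn g v + param_integral_Rn h v).
Proof.
elim: n V g h => [//|n IH] V g h hV sg sh fg fh.
have hVR : has_coordinates (V * R)%type.
  by apply: has_coordinates_prod => //; exact: has_coordinates_R.
have [sg' fg'] := (smooth_unroll sg, fiber_bounded_unroll fg).
have [sh' fh'] := (smooth_unroll sh, fiber_bounded_unroll fh).
have E := IH _ _ _ hVR sg' sh' fg' fh'.
rewrite -[LHS]/(param_integral (param_integral_Rn (fun z => a * (g \o @unroll V n) z +
  (h \o @unroll V n) z))) E.
have [sJg _] := param_integral_Rn_smooth hVR sg' fg'.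
have [sJh _] := param_integral_Rn_smooth hVR sh' fh'.
exact: (param_integral_linear a sJg sJh (fiber_bounded_integral fg)
  (fiber_bounded_integral fh)).
Qed.

(** The inductive step of [param_integral_Rn_derive_fiber]: a derivative along
the fibre is split into its component along the outermost integration variable,
which is removed by the fundamental theorem of calculus, and the remaining ones. *)
Lemma integral_split_zero n V (D D1 D2 : (V * R) * 'rV[R]_n -> R) (J : V * R -> R)
    (t : R) : has_coordinates (V * R)%type ->
  D = (fun z => t * D1 z + D2 z) ->
  smooth D1 -> fiber_bounded D1 -> smooth D2 -> fiber_bounded D2 ->
  param_integral_Rn D2 = (fun=> 0) ->
  smooth J -> fiber_bounded J -> 'D_(0 : V, 1 : R) J = param_integral_Rn D1 ->
  param_integral (param_integral_Rn D) = (fun=> 0).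
Proof.
move=> hVR -> sD1 fD1 sD2 fD2 D20 sJ fJ JD1.
rewrite (param_integral_Rn_linear t hVR sD1 sD2 fD1 fD2) D20 -JD1.
rewrite (param_integral_linear t (smooth_derive _ sJ) (smooth_cst 0)
  (fiber_bounded_derive _ fJ)); last by move=> r; exists 0.
rewrite (param_integral_derive_fiber sJ fJ); apply/funext => v; rewrite mulr0 add0r.
exact: (integral_Rn0 1).
Qed.

(** Integration by parts without boundary terms.  For the coordinates other than
the outermost one the inner integral already vanishes, and for the outermost one
the derivative can be pulled out of the inner integral, so the order of
integration never has to be exchanged. *)
Theorem param_integral_Rn_derive_fiber n V (g : V * 'rV[R]_n -> R) u :
  has_coordinates V -> smooth g -> fiber_bounded g ->
  param_integral_Rn ('D_(0 : V, u) g) = (fun=> 0).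
Proof.
elim: n V g u => [|n IH] V g u hV sg fg.
  by rewrite (thinmx0 u) (_ : 'D_(0, 0) g = cst 0)//; apply/funext => x; exact: derive0.
have hVR : has_coordinates (V * R)%type.
  by apply: has_coordinates_prod => //; exact: has_coordinates_R.
have [sg' fg'] := (smooth_unroll sg, fiber_bounded_unroll fg).
pose t : R := u 0 0; pose w : 'rV[R]_n := rsubmx (u : 'rV_(1 + n)).
have uE : (0 : V, u) = unroll ((0 : V, t), w).
  congr (_, _); rewrite /= -[LHS](@hsubmxK _ 1 1 n) [lsubmx _]mx11_scalar !mxE.
  by congr (row_mx (_ )%:M _); congr (u _ _); exact/val_inj.
rewrite -[LHS]/(param_integral (param_integral_Rn ('D_(0 : V, u) g \o @unroll V n))).
rewrite uE derive_unroll//.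
have zE : ((0 : V, t), w) = t *: ((0 : V, 1 : R), 0 : 'rV[R]_n) + (0, w).
  congr (_, _); rewrite /= ?scaler0 ?add0r//.
  by congr (_, _); rewrite /= ?scaler0 ?addr0// [_ *: _]mulr1.
have [sJ dJ] := param_integral_Rn_smooth hVR sg' fg'.
apply: (integral_split_zero hVR _ _ _ _ _ _ sJ (fiber_bounded_integral fg) (dJ (0, 1))).
- apply/funext => z.
  by rewrite zE (derive_dirD _ _ _ sg') (derive_dirZ t _ _ sg').
- exact: smooth_derive.
- exact: fiber_bounded_derive.
- exact: smooth_derive.
- exact: fiber_bounded_derive.
- exact: (IH _ _ w hVR sg' fg').
Qed.

End IntegralRn.

(** * The formal adjoint of the momentum ray transform *)

Section RayAdjoint.
Context {R : realType} {n : nat}.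
Local Notation E := ('rV[R]_n).
Implicit Types (phi chi : E * E -> R).

(** Test functions with the support condition in quantitative form: the support is
bounded and stays at distance at least c from xi = 0.  The estimates below use it
in this form, and it is visibly stable under derivatives and multiplication. *)
Definition ray_test phi := smooth phi /\
  exists B c : R, 0 < c /\ forall z, B < `|z| \/ `|z.2| < c -> phi z = 0.

Lemma test_function_ray_test phi : test_function phi -> ray_test phi.
Proof.
move=> [sphi cphi phi0]; split => //.
have out z : ~ closed_support phi z -> phi z = 0.
  move=> nz; apply/eqP/negP => pz; apply: nz; apply: subset_closure => /=.
  exact/negP.
have [M [Mreal HM]] := compact_bounded cphi.
have {}HM z : closed_support phi z -> `|z| <= M + 1.
  by apply: HM; rewrite ltrDl.
have [c c0 Hc] : exists2 c : R, 0 < c & forall z, closed_support phi z -> c <= `|z.2|.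
  have [[z0 Kz0]|K0] := pselect (closed_support phi !=set0); last first.
    by exists 1 => // z Kz; exfalso; apply: K0; exists z.
  have c2 : continuous (fun z : E * E => `|z.2|).
    by move=> z; apply: continuous_comp; [exact: cvg_snd|exact: norm_continuous].
  have [z1 z1K z1min] := compact_EVT_min (ex_intro _ z0 Kz0) cphi (continuous_subspaceT c2).
  exists `|z1.2|; first by rewrite normr_gt0; apply: phi0; exact/set_mem.
  by move=> z Kz; apply: z1min; exact/mem_set.
exists (M + 1), c; split=> // z [Bz|cz]; apply: out => Kz.
  by move: Bz; rewrite ltNge HM.
by move: cz; rewrite ltNge Hc.
Qed.

Lemma ray_test_lin a phi chi : ray_test phi -> ray_test chi ->
  ray_test (fun z => a * phi z + chi z).
Proof.
move=> [sp [B [c [c0 p0]]]] [sx [B' [c' [c'0 x0]]]]; split.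
  by apply: smoothD => //; apply: smoothM => //; exact: smooth_cst.
exists (Num.max B B'), (Num.min c c'); split; first by rewrite lt_min c0.
move=> z; rewrite gt_max lt_min => H; rewrite p0 ?x0 ?mulr0 ?addr0//.
  by case: H => /andP[]; [left|right].
by case: H => /andP[]; [left|right].
Qed.

Lemma ray_test_mul q phi : smooth q -> ray_test phi -> ray_test (fun z => q z * phi z).
Proof.
move=> sq [sp [B [c [c0 p0]]]]; split; first exact: smoothM.
by exists B, c; split => // z /p0 ->; rewrite mulr0.
Qed.

Lemma ray_test0 : ray_test (fun=> 0).
Proof. by split; [exact: smooth_cst|exists 0, 1]. Qed.

Lemma ray_test_sum (I : Type) (r : seq I) (phi : I -> E * E -> R) :
  (forall i, ray_test (phi i)) -> ray_test (fun z => \sum_(i <- r) phi i z).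
Proof.
move=> tp; elim: r => [|i r IH].
  rewrite (_ : (fun _ => _) = fun=> 0); first exact: ray_test0.
  by apply/funext => z; rewrite big_nil.
rewrite (_ : (fun _ => _) = (fun z => 1 * phi i z + \sum_(i <- r) phi i z)).
  exact: ray_test_lin.
by apply/funext => z; rewrite big_cons mul1r.
Qed.

Lemma ray_test_derive u phi : ray_test phi -> ray_test ('D_u phi).
Proof.
move=> [sp [B [c [c0 p0]]]]; split; first exact: smooth_derive.
exists B, c; split=> // z H.
rewrite (@near_eq_derive _ _ _ phi (cst 0)) ?derive_cst//.
have o1 : open [set z : E * E | B < `|z|].
  apply: (@open_comp _ _ (fun z : E * E => `|z|) [set s | B < s]); last exact: open_gt.
  by move=> w _; exact: norm_continuous.
have o2 : open [set z : E * E | `|z.2| < c].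
  apply: (@open_comp _ _ (fun z : E * E => `|z.2|) [set s | s < c]); last exact: open_lt.
  by move=> w _; apply: continuous_comp; [exact: cvg_snd|exact: norm_continuous].
have nz : nbhs z [set z : E * E | B < `|z| \/ `|z.2| < c].
  by apply: open_nbhs_nbhs; split; [exact: openU|].
by apply: filterS nz => w; exact: p0.
Qed.

Definition ray_map (z : (E * E) * R) : E * E := (z.1.1 - z.2 *: z.1.2, z.1.2).

Lemma smooth_lin_comp (V W : normedModType R) (l : {linear W -> R^o}) (A : {linear V -> W}) :
  continuous (l : W -> R) -> continuous A -> smooth (fun z : V => l (A z) : R).
Proof. by move=> cl cA; apply: (smooth_comp_lin cA); exact: smooth_lin. Qed.

Lemma continuous_fst (V W : normedModType R) : continuous (fst : V * W -> V).
Proof. by move=> z; exact: cvg_fst. Qed.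

Lemma continuous_snd (V W : normedModType R) : continuous (snd : V * W -> W).
Proof. by move=> z; exact: cvg_snd. Qed.

Lemma smooth_snd (V : normedModType R) : smooth (snd : V * R -> R).
Proof. by apply: (@smooth_lin _ _ (snd : {linear (V * R)%type -> R^o})); exact: continuous_snd. Qed.

Lemma ray_map_smooth : smooth_map ray_map.
Proof.
move=> l cl.
pose inj (x : E) : E * E := (x, 0).
have injlin : linear inj by move=> a u v; congr (_, _); rewrite /= scaler0 addr0.
pose injp : {linear E -> (E * E)%type} :=
  HB.pack inj (GRing.isLinear.Build R E (E * E)%type *:%R inj injlin).
have cinj : continuous injp by apply: continuous_pair; [move=> v; exact: cvg_id|exact: cst_continuous].
have -> : (fun v => l (ray_map v) : R) =
    (fun z => l z.1 + - (z.2 * (l ((injp \o (snd \o fst)) z)))).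
  apply/funext => -[[x xi] t].
  have -> : ray_map ((x, xi), t) = (x, xi) + - (t *: inj xi).
    congr (_, _) => /=; last by rewrite scaler0 oppr0 addr0.
  by rewrite linearD linearN linearZ.
apply: smoothD.
  by apply: (@smooth_lin_comp _ _ l fst) => //; exact: continuous_fst.
apply/smoothN/smoothM; first exact: smooth_snd.
apply: (@smooth_lin_comp _ _ l (injp \o (snd \o fst))) => //.
move=> z; apply: continuous_comp; last exact: cinj.
by apply: continuous_comp; [exact: continuous_fst|exact: continuous_snd].
Qed.

Lemma has_coordinates_EE : has_coordinates (E * E)%type.
Proof. by apply: has_coordinates_prod; exact: has_coordinates_rV. Qed.

Definition ray_integrand k phi (z : (E * E) * R) : R := z.2 ^+ k * phi (ray_map z).

Lemma smooth_ray_integrand k phi : smooth phi -> smooth (ray_integrand k phi).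
Proof.
move=> sp; apply: smoothM; first by apply: smoothX; exact: smooth_snd.
exact: (smooth_comp has_coordinates_EE sp ray_map_smooth).
Qed.

(** On the support, |xi| >= c and |x - t xi| <= B, whence c |t| <= B + |x|. *)
Lemma fiber_bounded_ray_integrand k phi : ray_test phi ->
  fiber_bounded (ray_integrand k phi).
Proof.
move=> [sp [B [c [c0 p0]]]] r; exists ((B + r) / c) => -[x xi] t.
rewrite prod_normE /= gt_max => /andP[xr xir] Bt.
rewrite /ray_integrand /= p0 ?mulr0//=.
have [cxi|] := ltP `|xi| c; first by right.
move=> cxi; left; rewrite prod_normE lt_max /ray_map/=; apply/orP; left.
have : B + r < `|t| * `|xi|.
  by move: Bt; rewrite ltr_pdivrMr// => /lt_le_trans; apply; rewrite ler_wpM2l.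
rewrite -normrZ => H.
have := ler_normB x (x - t *: xi); rewrite opprB addrC subrK => H2.
lra.
Qed.

Definition ray_integral k phi : E * E -> R := param_integral (ray_integrand k phi).

Lemma smooth_ray_integral k phi : ray_test phi -> smooth (ray_integral k phi).
Proof.
move=> tp; apply: param_integral_smooth; first exact: has_coordinates_EE.
  by apply: smooth_ray_integrand; case: tp.
exact: fiber_bounded_ray_integrand.
Qed.

Lemma ray_integral_zero k phi z :
  (forall t, phi (ray_map (z, t)) = 0) -> ray_integral k phi z = 0.
Proof.
move=> H; rewrite -(integral_Rn0 1); apply: eq_Rintegral => t _.
by rewrite /ray_integrand H mulr0.
Qed.

Lemma fiber_bounded_ray_integral k phi : ray_test phi ->
  fiber_bounded (ray_integral k phi).
Proof.
move=> [sp [B [c [c0 p0]]]] r; exists B => x xi _ Bxi.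
apply: ray_integral_zero => t; apply: p0; left.
by rewrite prod_normE lt_max /= Bxi orbT.
Qed.

Lemma ray_integral_linear k a phi chi : ray_test phi -> ray_test chi ->
  ray_integral k (fun z => a * phi z + chi z) =
  (fun z => a * ray_integral k phi z + ray_integral k chi z).
Proof.
move=> tp tx; rewrite -param_integral_linear; last 4 first.
- by apply: smooth_ray_integrand; case: tp.
- by apply: smooth_ray_integrand; case: tx.
- exact: fiber_bounded_ray_integrand.
- exact: fiber_bounded_ray_integrand.
congr param_integral; apply/funext => z; rewrite /ray_integrand; ring.
Qed.

Definition ray_adjoint k phi : E -> R := param_integral_Rn (ray_integral k phi).

Lemma momentum_adjointE k p (i : p.-tuple 'I_n) phi :
  momentum_adjoint k i phi = ray_adjoint k (fun z => monomial i z.2 * phi z).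
Proof.
apply/funext => x; rewrite /momentum_adjoint /ray_adjoint /param_integral_Rn.
congr integral_Rn; apply/funext => xi; apply: eq_Rintegral => t _.
by rewrite /ray_integrand /= mulrA.
Qed.

Lemma smooth_ray_adjoint k phi : ray_test phi -> smooth (ray_adjoint k phi).
Proof.
move=> tp; have [] // := param_integral_Rn_smooth (has_coordinates_rV n)
  (smooth_ray_integral k tp) (fiber_bounded_ray_integral k tp).
Qed.

Lemma ray_adjoint_linear k a phi chi : ray_test phi -> ray_test chi ->
  ray_adjoint k (fun z => a * phi z + chi z) =
  (fun x => a * ray_adjoint k phi x + ray_adjoint k chi x).
Proof.
move=> tp tx; rewrite -param_integral_Rn_linear; last 5 first.
- exact: has_coordinates_rV.
- exact: smooth_ray_integral.
- exact: smooth_ray_integral.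
- exact: fiber_bounded_ray_integral.
- exact: fiber_bounded_ray_integral.
by congr param_integral_Rn; exact: ray_integral_linear.
Qed.

(** Along (0, e) in the parameter (x, xi), the point (x - t xi, xi) moves with
velocity (- t e, e); the factor t raises the moment. *)
Lemma ray_integrand_dxi k phi (e : E) : smooth phi ->
  'D_((0, e), 0 : R) (ray_integrand k phi) =
  (fun z => -1 * ray_integrand k.+1 ('D_(e, 0) phi) z +
            ray_integrand k ('D_(0, e) phi) z).
Proof.
move=> sp; apply/funext => z.
have s1 : smooth (fun z : E * E * R => z.2 ^+ k) by apply: smoothX; exact: smooth_snd.
have s2 := smooth_comp has_coordinates_EE sp ray_map_smooth.
have -> := congr1 (@^~ z) (deriveME ((0, e), 0 : R) s1 s2).
have -> : 'D_(0, e, 0) (fun z : E * E * R => z.2 ^+ k) z = 0.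
  by apply: derive_invariant => s /=; rewrite scaler0 add0r.
rewrite mul0r add0r.
rewrite (@derive_along _ _ _ phi ray_map z ((0, e), 0 : R) (- z.2 *: (e, 0) + (0, e))).
  rewrite (derive_dirD _ _ _ sp) (derive_dirZ _ _ _ sp) /ray_integrand exprSr; ring.
case: z => [[x xi] t] s; congr (_, _) => /=; last first.
  by rewrite scaler0 add0r.
have -> : s *: (- t *: e + 0) = - (t *: (s *: e)).
  by rewrite addr0 scaleNr scalerN !scalerA mulrC.
by rewrite !scaler0 !add0r scalerDr opprD addrCA.
Qed.

(** Moving t moves the point (x - t xi, xi) with velocity (- xi, 0). *)
Lemma ray_integrand_dt phi : smooth phi ->
  'D_(0, 1 : R) (ray_integrand 1 phi) =
  (fun z => -1 * ray_integrand 1 (fun w => 'D_(w.2, 0) phi w) z + ray_integrand 0 phi z).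
Proof.
move=> sp; apply/funext => z.
have s1 : smooth (fun z : E * E * R => z.2 ^+ 1) by apply: smoothX; exact: smooth_snd.
have s2 := smooth_comp has_coordinates_EE sp ray_map_smooth.
have -> := congr1 (@^~ z) (deriveME (0, 1 : R) s1 s2).
have -> : 'D_(0, 1) (fun z : E * E * R => z.2 ^+ 1) z = 1.
  have cs : continuous (snd : E * E * R -> R) by exact: continuous_snd.
  exact: (congr1 (@^~ z) (@derive_linE _ _ (snd : {linear (E * E * R)%type -> R^o}) (0, 1) cs)).
rewrite (@derive_along _ _ _ phi ray_map z (0, 1 : R) (-1 *: (z.1.2, 0))).
  rewrite (derive_dirZ _ _ _ sp) /ray_integrand /= expr0 expr1; ring.
case: z => [[x xi] t] s; congr (_, _) => /=.
  by rewrite !scaler0 !add0r scalerDl opprD addrCA scaleN1r scalerN [s *: 1]mulr1.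
by rewrite !scaler0.
Qed.

End RayAdjoint.

(** * Integration by parts along rays and in the direction variable *)

Section RayIdentities.
Context {R : realType} {n : nat}.
Local Notation E := ('rV[R]_n).
Local Notation e_ := (@basis_vec R n).
Implicit Types (phi chi : E * E -> R) (q h : E -> R).

(** The xi-derivative of the inner integral, which integrates to zero over xi, is
the difference of the two sides. *)
Lemma ray_adjoint_dxi k phi (v : E) : ray_test phi ->
  ray_adjoint k ('D_(0, v) phi) = ray_adjoint k.+1 ('D_(v, 0) phi).
Proof.
move=> tp; have [sp _] := tp.
have tx := ray_test_derive (v, 0) tp; have ty := ray_test_derive (0, v) tp.
have H : 'D_(0, v) (ray_integral k phi) =
    (fun z => -1 * ray_integral k.+1 ('D_(v, 0) phi) z + ray_integral k ('D_(0, v) phi) z).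
  rewrite /ray_integral (param_integral_derive (0, v) has_coordinates_EE
    (smooth_ray_integrand k sp) (fiber_bounded_ray_integrand k tp)).
  rewrite ray_integrand_dxi// param_integral_linear//;
    by [apply: smooth_ray_integrand; exact: smooth_derive|exact: fiber_bounded_ray_integrand].
have := param_integral_Rn_derive_fiber v (has_coordinates_rV n)
  (smooth_ray_integral k tp) (fiber_bounded_ray_integral k tp).
rewrite H (param_integral_Rn_linear (-1) (has_coordinates_rV n)
  (smooth_ray_integral k.+1 tx) (smooth_ray_integral k ty)
  (fiber_bounded_ray_integral k.+1 tx) (fiber_bounded_ray_integral k ty)).
move=> H0; apply/funext => x; have := congr1 (@^~ x) H0; rewrite /ray_adjoint /=.
by rewrite mulN1r addrC => /subr0_eq.
Qed.

Lemma smooth_coord (j : 'I_n) : smooth (fun v : E => v 0 j).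
Proof. exact: (@smooth_lin _ _ (@coord_lin R n j : {linear _ -> _}) (@continuous_coord R n j)). Qed.

Lemma derive_coord (j : 'I_n) (v x : E) : 'D_v (fun v : E => v 0 j) x = v 0 j.
Proof.
exact: (congr1 (@^~ x) (@derive_linE _ _ (@coord_lin R n j : {linear _ -> _})
  v (@continuous_coord R n j))).
Qed.

Lemma smooth_on_xi q : smooth q -> smooth (fun z : E * E => q z.2).
Proof.
by move=> sq; exact: (@smooth_comp_lin _ _ _ (snd : {linear (E * E)%type -> E}) q
  (@continuous_snd _ _ _) sq).
Qed.

Lemma derive_on_xi q (u : E * E) z : smooth q ->
  'D_u (fun z : E * E => q z.2) z = 'D_(u.2) q z.2.
Proof.
move=> sq; exact: (congr1 (@^~ z) (@derive_comp_lin _ _ _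
  (snd : {linear (E * E)%type -> E}) q u (@continuous_snd _ _ _) sq)).
Qed.

Definition mul_xi (q : E -> R) phi (z : E * E) : R := q z.2 * phi z.

Lemma ray_test_mul_xi q phi : smooth q -> ray_test phi -> ray_test (mul_xi q phi).
Proof. by move=> sq; apply: ray_test_mul; exact: smooth_on_xi. Qed.

Lemma derive_mul_xi q phi (u : E * E) : smooth q -> smooth phi ->
  'D_u (mul_xi q phi) = (fun z => 1 * mul_xi ('D_(u.2) q) phi z + mul_xi q ('D_u phi) z).
Proof.
move=> sq sp; rewrite /mul_xi (deriveME u (smooth_on_xi sq) sp).
by apply/funext => z; rewrite derive_on_xi// mul1r.
Qed.

Lemma derive_x_mul_xi q phi (v : E) : smooth q -> smooth phi ->
  'D_(v, 0) (mul_xi q phi) = mul_xi q ('D_(v, 0) phi).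
Proof.
move=> sq sp; rewrite derive_mul_xi//; apply/funext => z.
by rewrite /mul_xi derive0 mul0r mulr0 add0r.
Qed.

Lemma ray_adjoint_mul_dxi k q phi (v : E) : smooth q -> ray_test phi ->
  ray_adjoint k (mul_xi q ('D_(0, v) phi)) = (fun x =>
   -1 * ray_adjoint k (mul_xi ('D_v q) phi) x +
   ray_adjoint k.+1 (mul_xi q ('D_(v, 0) phi)) x).
Proof.
move=> sq tp; have [sp _] := tp.
have sdq := smooth_derive v sq.
have := ray_adjoint_dxi k v (ray_test_mul_xi sq tp).
rewrite (derive_x_mul_xi v sq sp) (derive_mul_xi (0, v) sq sp).
rewrite (ray_adjoint_linear k 1 (ray_test_mul_xi sdq tp)
  (ray_test_mul_xi sq (ray_test_derive (0, v) tp))).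
by move=> <-; apply/funext => x; rewrite mul1r mulN1r addKr.
Qed.

(** The divergence in xi of xi phi, that is n phi + xi . d_xi phi: minus the
formal adjoint of the Euler operator. *)
Definition div_xi phi (z : E * E) : R :=
  \sum_j 'D_(0, e_ j) (mul_xi (fun v => v 0 j) phi) z.

Lemma ray_test_div_xi phi : ray_test phi -> ray_test (div_xi phi).
Proof.
move=> tp; apply: ray_test_sum => j; apply/ray_test_derive/ray_test_mul_xi => //.
exact: smooth_coord.
Qed.

Lemma ray_adjoint0 k : ray_adjoint k (fun _ : E * E => 0 : R) = fun=> 0.
Proof.
have t0 := @ray_test0 R n; have := ray_adjoint_linear k (-1) t0 t0.
have -> : (fun z : E * E => -1 * 0 + 0 : R) = (fun=> 0).
  by apply/funext => z; rewrite mulr0 addr0.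
by move=> H; apply/funext => x; rewrite H mulN1r addNr.
Qed.

Lemma ray_adjoint_sum k (I : Type) (r : seq I) (phi : I -> E * E -> R) :
  (forall i, ray_test (phi i)) ->
  ray_adjoint k (fun z => \sum_(i <- r) phi i z) =
  (fun x => \sum_(i <- r) ray_adjoint k (phi i) x).
Proof.
move=> tp; elim: r => [|i r IH].
  rewrite (_ : (fun _ => _) = fun=> 0); last by apply/funext => z; rewrite big_nil.
  by rewrite ray_adjoint0; apply/funext => x; rewrite big_nil.
have -> : (fun z : E * E => \sum_(j <- i :: r) phi j z) =
    (fun z => 1 * phi i z + \sum_(j <- r) phi j z).
  by apply/funext => z; rewrite big_cons mul1r.
rewrite ray_adjoint_linear//; last exact: ray_test_sum.
by apply/funext => x; rewrite IH big_cons mul1r.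
Qed.

(** Integration by parts in t: the t-derivative of t phi (x - t xi, xi) integrates
to zero. *)
Lemma ray_adjoint_dilation phi : ray_test phi ->
  ray_adjoint 1 (fun w => 'D_(w.2, 0) phi w) = ray_adjoint 0 phi.
Proof.
move=> tp; have [sp _] := tp.
have E1 : (fun w => 'D_(w.2, 0) phi w) =
    (fun w => \sum_j mul_xi (fun v => v 0 j) ('D_(e_ j, 0) phi) w).
  apply/funext => w; rewrite {1}[w.2]row_sum_delta derive_fst_coords//.
have te : ray_test (fun w => 'D_(w.2, 0) phi w).
  rewrite E1; apply: ray_test_sum => j; apply: ray_test_mul_xi; first exact: smooth_coord.
  exact: ray_test_derive.
congr param_integral_Rn.
have se : smooth (fun w => 'D_(w.2, 0) phi w) by case: te.
have := param_integral_derive_fiber (smooth_ray_integrand 1 sp) (fiber_bounded_ray_integrand 1 tp).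
rewrite ray_integrand_dt// (param_integral_linear (-1) (smooth_ray_integrand 1 se)
  (smooth_ray_integrand 0 sp) (fiber_bounded_ray_integrand 1 te)
  (fiber_bounded_ray_integrand 0 tp)).
move=> H0; apply/funext => x; have := congr1 (@^~ x) H0; rewrite /ray_integral /=.
by rewrite mulN1r addrC => /subr0_eq.
Qed.

(** By [ray_adjoint_dxi] the xi-derivatives become x-derivatives of first moments,
and [ray_adjoint_dilation] evaluates the resulting sum. *)
Lemma ray_adjoint_div_xi phi : ray_test phi ->
  ray_adjoint 0 (div_xi phi) = ray_adjoint 0 phi.
Proof.
move=> tp; have [sp _] := tp.
have tm j : ray_test (mul_xi (fun v => v 0 j) phi).
  by apply: ray_test_mul_xi => //; exact: smooth_coord.
rewrite /div_xi ray_adjoint_sum; last by move=> j; exact: ray_test_derive.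
rewrite -ray_adjoint_dilation//.
have -> : (fun w => 'D_(w.2, 0) phi w) =
    (fun w => \sum_j 'D_(e_ j, 0) (mul_xi (fun v => v 0 j) phi) w).
  apply/funext => w; rewrite {1}[w.2]row_sum_delta derive_fst_coords//.
  apply: eq_bigr => j _.
  exact: (esym (congr1 (@^~ w) (derive_x_mul_xi (e_ j) (smooth_coord j) sp))).
rewrite ray_adjoint_sum; last by move=> j; exact: ray_test_derive.
by apply/funext => x; apply: eq_bigr => j _; rewrite ray_adjoint_dxi.
Qed.

End RayIdentities.

(** * Homogeneous weights and the Euler operator *)

Lemma big_tuple_cons (C : nmodType) (T : finType) k (F : k.+1.-tuple T -> C) :
  \sum_l F l = \sum_y \sum_(l : k.-tuple T) F [tuple of y :: l].
Proof.
rewrite pair_big /=.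
rewrite (reindex (fun p : T * k.-tuple T => [tuple of p.1 :: p.2])) /=; first by [].
exists (fun l : k.+1.-tuple T => (thead l, [tuple of behead l])).
  by move=> [y l] _ /=; congr (_, _); exact: val_inj.
by move=> l _ /=; rewrite [RHS]tuple_eta.
Qed.

Section Homogeneous.
Context {R : realType} {n : nat}.
Local Notation E := ('rV[R]_n).
Local Notation e_ := (@basis_vec R n).
Local Notation Y_ := (fun a : 'I_n => (0, e_ a) : E * E).
Implicit Types (phi chi : E * E -> R) (h : E -> R).

Lemma monomial_cons k (y : 'I_n) (l : k.-tuple 'I_n) (xi : E) :
  monomial [tuple of y :: l] xi = xi 0 y * monomial l xi.
Proof.
rewrite /monomial big_ord_recl /=; congr (xi 0 _ * _).
by apply: eq_bigr => a _; congr (xi 0 _); rewrite !(tnth_nth y).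
Qed.

Lemma smooth_monomial k (l : k.-tuple 'I_n) : smooth (@monomial R n k l).
Proof.
elim: k l => [|k IH] l.
  rewrite (_ : monomial l = fun=> 1); first exact: smooth_cst.
  by apply/funext => xi; rewrite /monomial big_ord0.
case/tupleP: l => y l; rewrite (_ : monomial _ = fun xi => xi 0 y * monomial l xi).
  by apply: smoothM; [exact: smooth_coord|exact: IH].
by apply/funext => xi; exact: monomial_cons.
Qed.

(** Homogeneity of degree q in the form of Euler's identity. *)
Definition homogeneous (q : R) h := smooth h /\ forall xi, 'D_xi h xi = q * h xi.

Lemma homogeneous_monomial k (l : k.-tuple 'I_n) : homogeneous k%:R (@monomial R n k l).
Proof.
split; first exact: smooth_monomial.
elim: k l => [|k IH] l xi.
  rewrite (_ : monomial l = fun=> 1); first by rewrite derive_cst mul0r.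
  by apply/funext => v; rewrite /monomial big_ord0.
case/tupleP: l => y l; rewrite (_ : monomial _ = fun xi => xi 0 y * monomial l xi).
  have -> := congr1 (@^~ xi) (deriveME xi (smooth_coord y) (smooth_monomial l)).
  by rewrite derive_coord IH -natr1; ring.
by apply/funext => v; exact: monomial_cons.
Qed.

Lemma derive_dir_coords h (v x : E) : smooth h ->
  'D_v h x = \sum_j v 0 j * 'D_(e_ j) h x.
Proof.
move=> sh; rewrite {1}[v]row_sum_delta derive_dir_sum//.
by apply: eq_bigr => j _; rewrite derive_dirZ.
Qed.

(** Differentiating Euler's identity along v, where the second derivatives are
exchanged. *)
Lemma homogeneous_derive q h v : homogeneous q h -> homogeneous (q - 1) ('D_v h).
Proof.
move=> [sh hE]; split; first exact: smooth_derive.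
move=> xi; have sm j : smooth (fun w : E => w 0 j * 'D_(e_ j) h w).
  by apply: smoothM; [exact: smooth_coord|exact: smooth_derive].
have EE : (fun w : E => \sum_j w 0 j * 'D_(e_ j) h w) = (fun w => q * h w).
  by apply/funext => w; rewrite -hE -derive_dir_coords.
have := congr1 (fun g => 'D_v g xi) EE.
have -> := congr1 (@^~ xi) (deriveZE q v sh).
have -> := congr1 (@^~ xi) (derive_sumE (index_enum 'I_n) v sm).
have DE j : 'D_v (fun w : E => w 0 j * 'D_(e_ j) h w) xi =
    v 0 j * 'D_(e_ j) h xi + xi 0 j * 'D_(e_ j) ('D_v h) xi.
  have -> := congr1 (@^~ xi) (deriveME v (smooth_coord j) (smooth_derive (e_ j) sh)).
  rewrite derive_coord.
  exact: (congr1 (fun g : E -> R => v 0 j * 'D_(e_ j) h xi + xi 0 j * g xi)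
    (deriveC v (e_ j) sh)).
have S : \sum_j 'D_v (fun w : E => w 0 j * 'D_(e_ j) h w) xi =
    'D_v h xi + 'D_xi ('D_v h) xi.
  have A1 := derive_dir_coords v xi sh.
  have A2 := derive_dir_coords xi xi (smooth_derive v sh).
  transitivity (\sum_j v 0 j * 'D_(e_ j) h xi + \sum_j xi 0 j * 'D_(e_ j) ('D_v h) xi).
    by rewrite -big_split /=; apply: eq_bigr => j _; exact: DE.
  by congr (_ + _); [exact: esym A1|exact: esym A2].
by rewrite S => H; rewrite mulrBl mul1r -H addrC addKr.
Qed.

Lemma homogeneous_iterD q h (d : seq E) :
  homogeneous q h -> homogeneous (q - (size d)%:R) (iterD h d).
Proof.
move=> hh; elim: d => [|v d IH]; first by rewrite subr0.
by rewrite -natr1 opprD addrA; exact: homogeneous_derive.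
Qed.

Lemma div_xiE phi z : smooth phi -> div_xi phi z = n%:R * phi z + 'D_(0, z.2) phi z.
Proof.
move=> sp; rewrite /div_xi.
have DE j : 'D_(0, e_ j) (mul_xi (fun v : E => v 0 j) phi) z =
   phi z + z.2 0 j * 'D_(0, e_ j) phi z.
  have -> := congr1 (@^~ z) (derive_mul_xi (0, e_ j) (smooth_coord j) sp).
  by rewrite /mul_xi derive_coord /= mxE !eqxx !mul1r.
rewrite (eq_bigr _ (fun j _ => DE j)) big_split /=; congr (_ + _).
  by rewrite sumr_const card_ord mulr_natl.
rewrite {2}[z.2]row_sum_delta.
have -> : (0 : E, \sum_j z.2 0 j *: e_ j) = \sum_j z.2 0 j *: (0 : E, e_ j).
  elim: (index_enum _) => [|j r IH]; first by rewrite !big_nil.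
  by rewrite !big_cons -IH; congr (_, _); rewrite /= scaler0 addr0.
rewrite derive_dir_sum//; apply: eq_bigr => j _; by rewrite derive_dirZ.
Qed.

Lemma div_xi_mul q h phi : homogeneous q h -> smooth phi ->
  div_xi (mul_xi h phi) = (fun z => 1 * mul_xi h (div_xi phi) z + q * mul_xi h phi z).
Proof.
move=> [sh hE] sp; apply/funext => z.
have sm : smooth (mul_xi h phi) by apply: smoothM => //; exact: smooth_on_xi.
rewrite div_xiE//.
have -> := congr1 (@^~ z) (derive_mul_xi (0, z.2) sh sp).
rewrite /mul_xi /= hE div_xiE//; ring.
Qed.

Lemma ray_adjoint_mul_div_xi q h phi : homogeneous q h -> ray_test phi ->
  ray_adjoint 0 (mul_xi h (div_xi phi)) =
  (fun x => (1 - q) * ray_adjoint 0 (mul_xi h phi) x).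
Proof.
move=> hh tp; have [[sh _] [sp _]] := (hh, tp).
have tm := ray_test_mul_xi sh tp.
have td := ray_test_mul_xi sh (ray_test_div_xi tp).
have tq : ray_test (fun z => q * mul_xi h phi z).
  by apply: ray_test_mul => //; exact: smooth_cst.
have qE : ray_adjoint 0 (fun z => q * mul_xi h phi z) =
    (fun x => q * ray_adjoint 0 (mul_xi h phi) x).
  have := ray_adjoint_linear 0 q tm (@ray_test0 R n); rewrite ray_adjoint0.
  have -> : (fun z => q * mul_xi h phi z + 0) = (fun z => q * mul_xi h phi z).
    by apply/funext => z; rewrite addr0.
  by move=> ->; apply/funext => x; rewrite addr0.
have := ray_adjoint_div_xi tm; rewrite (div_xi_mul hh sp).
rewrite (ray_adjoint_linear 0 1 td tq) qE => H.
apply/funext => x; have Hx := congr1 (@^~ x) H.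
by rewrite mulrBl mul1r -[X in X - _]Hx mul1r addrK.
Qed.

(** Up to the sign (-1)^k, the formal adjoint of P_k (xi, d_xi). *)
Definition iter_div_xi k phi (z : E * E) : R :=
  \sum_(l : k.-tuple 'I_n) iterD (mul_xi (monomial l) phi) [seq Y_ a | a <- l] z.

Lemma ray_test_iterD vs phi : ray_test phi -> ray_test (iterD phi vs).
Proof. by move=> tp; elim: vs => [//|v vs IH]; exact: ray_test_derive. Qed.

Lemma iterD_sumE (V : normedModType R) (I : Type) (r : seq I) (f : I -> V -> R) vs :
  (forall i, smooth (f i)) ->
  iterD (fun x => \sum_(i <- r) f i x) vs = (fun x => \sum_(i <- r) iterD (f i) vs x).
Proof.
move=> sf; elim: vs => [//|v vs IH] /=; rewrite IH derive_sumE// => i.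
exact: smooth_iterD.
Qed.

(** One index of the k+1 is singled out and its pair (derivative, coordinate) is
commuted to the inside; the monomial in the other k indices is homogeneous of
degree k, which produces the term k phi. *)
Lemma iter_div_xiS k phi : smooth phi -> iter_div_xi k.+1 phi =
  iter_div_xi k (fun z => 1 * div_xi phi z + k%:R * phi z).
Proof.
move=> sp; apply/funext => z; rewrite /iter_div_xi big_tuple_cons exchange_big /=.
apply: eq_bigr => l _.
have sm : smooth (mul_xi (monomial l) phi).
  by apply: smoothM => //; apply/smooth_on_xi/smooth_monomial.
have smy y : smooth (mul_xi (fun v : E => v 0 y) (mul_xi (monomial l) phi)).
  by apply: smoothM => //; exact: (smooth_on_xi (smooth_coord y)).
have -> : mul_xi (monomial l) (fun z => 1 * div_xi phi z + k%:R * phi z) =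
    div_xi (mul_xi (monomial l) phi).
  rewrite (div_xi_mul (homogeneous_monomial l) sp); apply/funext => w.
  rewrite /mul_xi; ring.
rewrite /div_xi iterD_sumE; last by move=> y; exact: smooth_derive.
apply: eq_bigr => y _.
have -> : mul_xi (monomial [tuple of y :: l]) phi =
    mul_xi (fun v : E => v 0 y) (mul_xi (monomial l) phi).
  by apply/funext => w; rewrite /mul_xi monomial_cons mulrA.
transitivity (iterD (mul_xi (fun v : E => v 0 y) (mul_xi (monomial l) phi))
    ([seq Y_ a | a <- l] ++ [:: (0, e_ y)]) z); last by rewrite iterD_cat.
have pe : perm_eq ((0, e_ y) :: [seq Y_ a | a <- l]) ([seq Y_ a | a <- l] ++ [:: (0, e_ y)]).
  by rewrite perm_sym cats1 perm_rcons.
exact: (congr1 (@^~ z) (iterD_perm (smy y) pe)).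
Qed.

(** P_k = E (E - 1) ... (E - k + 1) for the Euler operator E, and the ray transform
weighted by h has degree q - 1; the product is this evaluation, up to (-1)^k. *)
Lemma ray_adjoint_iter_div_xi q h k phi : homogeneous q h -> ray_test phi ->
  ray_adjoint 0 (mul_xi h (iter_div_xi k phi)) =
  (fun x => (\prod_(r < k) (1 - q + r%:R)) * ray_adjoint 0 (mul_xi h phi) x).
Proof.
move=> hh; elim: k phi => [|k IH] phi tp; have [[sh _] [sp _]] := (hh, tp).
  apply/funext => x; rewrite big_ord0 mul1r; congr (ray_adjoint 0 (mul_xi h _) x).
  apply/funext => z; rewrite /iter_div_xi (big_pred1 [tuple]) /=; last first.
    by move=> l; rewrite [l]tuple0 /= eqxx.
  by rewrite /mul_xi /monomial big_ord0 mul1r.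
have tk : ray_test (fun z => k%:R * phi z) by apply: ray_test_mul => //; exact: smooth_cst.
rewrite iter_div_xiS// IH; last first.
  by apply: ray_test_lin => //; exact: ray_test_div_xi.
have E1 : mul_xi h (fun z => 1 * div_xi phi z + k%:R * phi z) =
   (fun z => k%:R * mul_xi h phi z + mul_xi h (div_xi phi) z).
  by apply/funext => z; rewrite /mul_xi; ring.
apply/funext => x; rewrite E1 (ray_adjoint_linear 0 _ (ray_test_mul_xi sh tp)
  (ray_test_mul_xi sh (ray_test_div_xi tp))) (ray_adjoint_mul_div_xi hh tp).
rewrite big_ord_recr /=; ring.
Qed.

End Homogeneous.

(** * Symmetrized alternating sums *)

Section Combinatorics.

(** Moves position a to the front and keeps the order of the others. *)
Definition front_perm j (a : 'I_j.+1) : 'S_j.+1 := lift_perm ord0 a 1.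

Lemma perm_tuple_front (T : Type) j (a : 'I_j.+1) (l : j.+1.-tuple T) :
  perm_tuple (front_perm a) l =
  [tuple of tnth l a :: [tuple tnth l (lift a b) | b < j]].
Proof.
apply: eq_from_tnth => b; rewrite tnth_mktuple.
case: (unliftP ord0 b) => [b' ->|->].
  by rewrite lift_perm_lift perm1 tnthS tnth_mktuple.
by rewrite lift_perm_id tnth0.
Qed.

Lemma perm_tuple_front_val (T : Type) (x0 : T) j (a : 'I_j.+1) (l : j.+1.-tuple T) :
  perm_tuple (front_perm a) l = nth x0 l a :: take a l ++ drop a.+1 l :> seq T.
Proof.
rewrite perm_tuple_front /= (tnth_nth x0); congr (_ :: _).
have sl := size_tuple l; have aj := ltn_ord a.
apply: (@eq_from_nth _ x0).
  by rewrite size_map size_enum_ord size_cat size_takel ?size_drop sl; lia.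
move=> b; rewrite size_map size_enum_ord => bj.
rewrite (nth_map (Ordinal bj)) ?size_enum_ord// (tnth_nth x0) /= nth_enum_ord//.
rewrite nth_cat size_takel; last by rewrite sl ltnW.
rewrite /bump; case: ltnP => ab.
  by rewrite add0n nth_take.
by rewrite nth_drop; congr nth; lia.
Qed.

Lemma perm_tupleM (T : Type) j (s t : 'S_j) (l : j.-tuple T) :
  perm_tuple t (perm_tuple s l) = perm_tuple (t * s)%g l.
Proof. by apply: eq_from_tnth => b; rewrite !tnth_mktuple permM. Qed.

Lemma sum_perm_tuple (C : nmodType) (T : Type) j (t : 'S_j) (l : j.-tuple T)
    (G : j.-tuple T -> C) :
  \sum_(s : 'S_j) G (perm_tuple t (perm_tuple s l)) = \sum_(s : 'S_j) G (perm_tuple s l).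
Proof.
rewrite [RHS](reindex_inj (mulgI t)) /=.
by apply: eq_bigr => s _; rewrite perm_tupleM.
Qed.

(** Pascal's rule as a summation by parts. *)
Lemma alternating_pascal (C : pzRingType) j (a : nat -> C) :
  \sum_(k < j.+2) (-1) ^+ k * 'C(j.+1, k)%:R * a k =
  \sum_(k < j.+1) (-1) ^+ k * 'C(j, k)%:R * (a k - a k.+1).
Proof.
rewrite big_ord_recl /= expr0 bin0 !mul1r.
rewrite (eq_bigr (fun k : 'I_j.+1 => (-1) ^+ k.+1 * 'C(j, k.+1)%:R * a k.+1 +
   (-1) ^+ k.+1 * 'C(j, k)%:R * a k.+1)); last first.
  by move=> k _; rewrite binS natrD mulrDr mulrDl.
rewrite big_split /= addrA.
have -> : a 0 + \sum_(k < j.+1) (-1) ^+ k.+1 * 'C(j, k.+1)%:R * a k.+1 =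
    \sum_(k < j.+1) (-1) ^+ k * 'C(j, k)%:R * a k.
  rewrite [RHS]big_ord_recl /= expr0 bin0 !mul1r big_ord_recr /= bin_small//.
  by rewrite mulr0 mul0r addr0.
rewrite -big_split /=; apply: eq_bigr => k _.
by rewrite mulrBr exprS mulN1r !mulNr.
Qed.

Section Alternation.
Context {T : eqType} {C : pzRingType} (Z : seq T -> seq T -> seq T -> C).
Hypothesis Z_step : forall t y l d, Z t (y :: l) d = Z (y :: t) l d - Z t l (y :: d).
Hypothesis Z_perm : forall t t' l d, perm_eq t t' -> Z t l d = Z t' l d.

(** The alternating sum of the formula, for Z t l d = the value obtained
from x-derivatives in t, xi-derivatives in l, and a weight differentiated along d. *)
Definition alternation (l d : seq T) : C :=
  \sum_(k < (size l).+1) (-1) ^+ k * 'C(size l, k)%:R * Z (take k l) (drop k l) d.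

(** Consecutive terms differ by the transfer of the k-th index from l to t, which
by the rule for Z costs exactly the term where this index goes to d. *)
Lemma alternation_step (x0 : T) j l d : size l = j.+1 -> alternation l d =
  - \sum_(k < j.+1) (-1) ^+ k * 'C(j, k)%:R * Z (take k l) (drop k.+1 l) (nth x0 l k :: d).
Proof.
move=> sl; rewrite /alternation sl.
rewrite (alternating_pascal j (fun k => Z (take k l) (drop k l) d)) -sumrN.
apply: eq_bigr => k _; rewrite -mulrN; congr (_ * _).
have kl : (k < size l)%N by rewrite sl.
rewrite (drop_nth x0 kl) Z_step (take_nth x0 kl).
by rewrite (@Z_perm (rcons _ _) (nth x0 l k :: take k l)) ?perm_rcons// addrAC subrr sub0r.
Qed.

(** After [alternation_step] the k-th index is the last one to have reached d.
Summing over all permutations makes its original position irrelevant: it can be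
moved to the front by a reindexing that depends on k only. *)
Lemma alternation_sum_step j (r : nat) (i : j.-tuple T) : (r < j)%N ->
  \sum_(s : 'S_j) alternation (drop r (perm_tuple s i)) (take r (perm_tuple s i)) =
  - \sum_(s : 'S_j) alternation (drop r.+1 (perm_tuple s i)) (take r.+1 (perm_tuple s i)).
Proof.
case: j i => [//|j] i rj; pose x0 := tnth i ord0.
have sz (r' : nat) s : size (drop r' (perm_tuple s i)) = (j.+1 - r')%N.
  by rewrite size_drop size_tuple.
pose G k (l : j.+1.-tuple T) :=
  Z (take k (drop r.+1 l)) (drop k (drop r.+1 l)) (take r.+1 l).
transitivity (- \sum_(s : 'S_j.+1) \sum_(k < (j - r).+1)
    (-1) ^+ k * 'C(j - r, k)%:R * G k (perm_tuple (front_perm (inord (r + k)))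
      (perm_tuple s i))).
  rewrite -sumrN; apply: eq_bigr => s _.
  rewrite (@alternation_step x0 (j - r)); last by rewrite sz; lia.
  congr (- _); apply: eq_bigr => k _; congr (_ * _).
  have kj := ltn_ord k; have rk : (r + k < j.+1)%N by lia.
  set l := perm_tuple s i; rewrite /G (perm_tuple_front_val x0) inordK//.
  have sl : size l = j.+1 by rewrite size_tuple.
  have st : size (take r l) = r by rewrite size_takel// sl ltnW.
  have stk : size (take k (drop r l)) = k by rewrite size_takel// size_drop sl; lia.
  rewrite /= takeD -catA (drop_size_cat _ st) (take_size_cat _ st).
  rewrite (drop_size_cat _ stk) (take_size_cat _ stk).
  by rewrite nth_drop drop_drop addSn addnC.
rewrite [in RHS](eq_bigr (fun s => \sum_(k < (j - r).+1)
    (-1) ^+ k * 'C(j - r, k)%:R * G k (perm_tuple s i))); last first.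
  by move=> s _; rewrite /alternation sz subSS.
congr (- _); rewrite exchange_big [RHS]exchange_big /=; apply: eq_bigr => k _.
by rewrite -!mulr_sumr sum_perm_tuple.
Qed.

Theorem alternation_sum j (i : j.-tuple T) :
  \sum_(s : 'S_j) alternation (perm_tuple s i) [::] =
  (-1) ^+ j * \sum_(s : 'S_j) Z [::] [::] (perm_tuple s i).
Proof.
have H r : (r <= j)%N -> \sum_(s : 'S_j) alternation (perm_tuple s i) [::] =
    (-1) ^+ r * \sum_(s : 'S_j) alternation (drop r (perm_tuple s i)) (take r (perm_tuple s i)).
  elim: r => [_|r IH rj].
    by rewrite mul1r; apply: eq_bigr => s _; rewrite drop0 take0.
  by rewrite (IH (ltnW rj)) alternation_sum_step// exprSr mulrN1 mulNr mulrN.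
rewrite (H j)//; congr (_ * _); apply: eq_bigr => s _.
rewrite drop_oversize ?take_oversize ?size_tuple//.
by rewrite /alternation /= big_ord1 expr0 bin0 !mul1r.
Qed.

End Alternation.

End Combinatorics.

(** * Derivatives of monomials and contraction with symmetric tensors *)

Local Open Scope complex_scope.

Section Contraction.
Context {R : realType}.

Lemma iterD_scaleE (V : normedModType R) (c : R) (f : V -> R) vs : smooth f ->
  iterD (fun x => c * f x) vs = (fun x => c * iterD f vs x).
Proof.
move=> sf; elim: vs => [//|v vs IH] /=; rewrite IH; apply: deriveZE.
exact: smooth_iterD.
Qed.

Lemma iterD_zero (V : normedModType R) (vs : seq V) :
  iterD (fun _ : V => 0 : R) vs = (fun=> 0).
Proof. by elim: vs => [//|v vs IH] /=; rewrite IH derive_cstE. Qed.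

Lemma lift_lift0 p (a : 'I_p.+1) (k : 'I_p) :
  lift (lift ord0 a) (lift ord0 k) = lift ord0 (lift a k).
Proof. by apply: val_inj; rewrite /= /bump /=; lia. Qed.

Lemma smooth_prod (V : normedModType R) p (f : 'I_p -> V -> R) :
  (forall i, smooth (f i)) -> smooth (fun x => \prod_(i < p) f i x).
Proof.
elim: p f => [|p IH] f sf.
  rewrite (_ : (fun _ => _) = fun=> 1); first exact: smooth_cst.
  by apply/funext => x; rewrite big_ord0.
rewrite (_ : (fun _ => _) = fun x => f ord0 x * \prod_(i < p) f (lift ord0 i) x).
  by apply: smoothM => //; apply: (IH (fun i => f (lift ord0 i))).
by apply/funext => x; rewrite big_ord_recl.
Qed.

Lemma derive_prod (V : normedModType R) p (f : 'I_p.+1 -> V -> R) v :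
  (forall i, smooth (f i)) ->
  'D_v (fun x => \prod_(i < p.+1) f i x) =
  (fun x => \sum_(a < p.+1) 'D_v (f a) x * \prod_(k < p) f (lift a k) x).
Proof.
elim: p f => [|p IH] f sf.
  rewrite (_ : (fun x => \prod_(i < 1) f i x) = f ord0); last first.
    by apply/funext => x; rewrite big_ord1.
  by apply/funext => x; rewrite big_ord1 big_ord0 mulr1.
rewrite (_ : (fun x => \prod_(i < p.+2) f i x) =
    fun x => f ord0 x * \prod_(i < p.+1) f (lift ord0 i) x); last first.
  by apply/funext => x; rewrite big_ord_recl.
rewrite (deriveME v (sf ord0) (smooth_prod (fun i => sf (lift ord0 i)))).
apply/funext => x; rewrite [RHS]big_ord_recl; congr (_ + _).
have -> := congr1 (@^~ x) (IH (fun i => f (lift ord0 i)) (fun i => sf (lift ord0 i))).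
rewrite mulr_sumr; apply: eq_bigr => a _; rewrite mulrCA; congr (_ * _).
rewrite big_ord_recl; congr (f _ x * _); first exact: val_inj.
by apply: eq_bigr => k _; rewrite lift_lift0.
Qed.

Context {n : nat}.
Local Notation E := ('rV[R]_n).
Local Notation e_ := (@basis_vec R n).

Definition remove_entry p (a : 'I_p.+1) (l : p.+1.-tuple 'I_n) : p.-tuple 'I_n :=
  [tuple tnth l (lift a b) | b < p].

Lemma derive_monomial p (l : p.+1.-tuple 'I_n) y : 'D_(e_ y) (monomial l) =
  (fun xi => \sum_a (tnth l a == y)%:R * monomial (remove_entry a l) xi).
Proof.
rewrite (derive_prod (e_ y) (fun a => smooth_coord (tnth l a))).
apply/funext => xi; apply: eq_bigr => a _; rewrite derive_coord mxE eqxx /=.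
congr (_ * _); apply: eq_bigr => b _; by rewrite tnth_mktuple.
Qed.

Lemma iterD_monomial_rcons p (l : p.+1.-tuple 'I_n) (d : seq 'I_n) y :
  iterD (monomial l) [seq e_ b | b <- rcons d y] =
  (fun xi => \sum_a (tnth l a == y)%:R *
    iterD (monomial (remove_entry a l)) [seq e_ b | b <- d] xi).
Proof.
rewrite map_rcons -cats1 iterD_cat /= derive_monomial iterD_sumE; last first.
  by move=> a; apply: smoothM; [exact: smooth_cst|exact: smooth_monomial].
apply/funext => xi; apply: eq_bigr => a _.
by rewrite (iterD_scaleE _ _ (smooth_monomial (remove_entry a l))).
Qed.

Lemma iterD_monomial_vanish p (l : p.-tuple 'I_n) (d : seq 'I_n) : (p < size d)%N ->
  iterD (@monomial R n p l) [seq e_ b | b <- d] = (fun=> 0).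
Proof.
elim: p l d => [|p IH] l d; case/lastP: d => [//|d y]; rewrite size_rcons ltnS.
  move=> _; rewrite map_rcons -cats1 iterD_cat /=.
  rewrite (_ : monomial l = fun=> 1); last by apply/funext => xi; rewrite /monomial big_ord0.
  by rewrite derive_cstE iterD_zero.
move=> pd; rewrite iterD_monomial_rcons; apply/funext => xi.
by rewrite big1// => a _; rewrite IH// mulr0.
Qed.

Lemma sum_perm_all (C : nmodType) p (s : 'S_p) (G : p.-tuple 'I_n -> C) :
  \sum_l G (perm_tuple s l) = \sum_l G l.
Proof.
rewrite [RHS](reindex (perm_tuple s))//.
have perm_tuple1 (l : p.-tuple 'I_n) : perm_tuple 1 l = l.
  by apply: eq_from_tnth => b; rewrite tnth_mktuple perm1.
exists (perm_tuple s^-1) => l _; rewrite perm_tupleM.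
  by rewrite mulVg perm_tuple1.
by rewrite mulgV perm_tuple1.
Qed.

(** Dually, the full polarization of the form sum_I g_I xi^I is p! times g.  Each
derivative d_y removes one entry equal to y from I; by symmetry of g the position
of that entry does not matter, whence a factor p + 1 at each step. *)
Lemma symmetric_contraction p (g : p.-tuple 'I_n -> R[i]) (d : p.-tuple 'I_n) :
  (forall (s : 'S_p) l, g (perm_tuple s l) = g l) ->
  \sum_l (iterD (@monomial R n p l) [seq e_ b | b <- d] 0)%:C * g l = p`!%:R * g d.
Proof.
elim: p g d => [|p IH] g d gs.
  rewrite (big_pred1 [tuple]) /=; last by move=> l; apply/esym/eqP; exact: tuple0.
  have -> : d = [tuple] by exact: tuple0.
  by rewrite /= /monomial big_ord0 rmorph1.
case/tupleP: d => y d.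
have sm (l : p.+1.-tuple 'I_n) := @smooth_monomial R n p.+1 l.
have pe : perm_eq [seq e_ b | b <- y :: d] [seq e_ b | b <- rcons d y].
  by apply: perm_map; rewrite perm_sym perm_rcons.
pose G (l : p.+1.-tuple 'I_n) : R[i] := ((thead l == y)%:R *
  iterD (@monomial R n p [tuple of behead l]) [seq e_ b | b <- d] 0)%:C * g l.
transitivity (\sum_l \sum_a G (perm_tuple (front_perm a) l)).
  apply: eq_bigr => l _; rewrite (iterD_perm (sm l) pe) iterD_monomial_rcons.
  rewrite rmorph_sum mulr_suml; apply: eq_bigr => a _.
  rewrite /G gs; congr ((_ * _)%:C * _); rewrite perm_tuple_front ?theadE//.
  by congr (iterD (monomial _) _ 0); exact: val_inj.
rewrite exchange_big /= (eq_bigr (fun=> \sum_l G l)); last first.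
  by move=> a _; exact: sum_perm_all.
rewrite sumr_const card_ord big_tuple_cons.
rewrite (bigD1 y)//= [X in _ + X]big1 ?addr0; last first.
  by move=> z zy; apply: big1 => l _; rewrite /G theadE (negbTE zy) mul0r rmorph0 mul0r.
have gs' (s : 'S_p) l : g [tuple of y :: perm_tuple s l] = g [tuple of y :: l].
  rewrite -(gs (lift_perm ord0 ord0 s) [tuple of y :: l]); congr g.
  apply: eq_from_tnth => b; rewrite [RHS]tnth_mktuple.
  case: (unliftP ord0 b) => [b' ->|->].
    by rewrite lift_perm_lift !tnthS tnth_mktuple.
  by rewrite lift_perm_id !tnth0.
have -> : \sum_(l : p.-tuple 'I_n) G [tuple of y :: l] = p`!%:R * g [tuple of y :: d].
  rewrite -(IH (fun l => g [tuple of y :: l]) d gs'); apply: eq_bigr => l _.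
  rewrite /G theadE eqxx mul1r; congr ((iterD (monomial _) _ 0)%:C * _).
  exact: val_inj.
by rewrite factS natrM -mulrA [RHS]mulr_natl.
Qed.

End Contraction.

(** * Pairing with the tensor field *)

Local Open Scope complex_scope.

Section Assembly.
Context {R : realType} {n : nat}.
Local Notation E := ('rV[R]_n).
Local Notation e_ := (@basis_vec R n).
Local Notation X_ := (fun a : 'I_n => (e_ a, 0) : E * E).
Local Notation Y_ := (fun a : 'I_n => (0, e_ a) : E * E).
Implicit Types (phi chi psi : E * E -> R) (u : functional R E).

Lemma iterD_monomial_cst p (l : p.-tuple 'I_n) (d : seq 'I_n) : size d = p ->
  forall xi, iterD (@monomial R n p l) [seq e_ b | b <- d] xi =
             iterD (@monomial R n p l) [seq e_ b | b <- d] 0.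
Proof.
elim: p l d => [|p IH] l d.
  by move=> /size0nil -> xi; rewrite /= /monomial !big_ord0.
case/lastP: d => [//|d y]; rewrite size_rcons => -[dp] xi.
rewrite iterD_monomial_rcons; apply: eq_bigr => a _; congr (_ * _); exact: IH.
Qed.

Lemma distribution_lin u (a : R) (f g : E -> R) :
  compactly_supported_distribution u -> smooth f -> smooth g ->
  u (fun x => a * f x + g x) = a%:C * u f + u g.
Proof. by move=> [ulin _] sf sg; exact: ulin. Qed.

Lemma distribution0 u : compactly_supported_distribution u -> u (fun=> 0) = 0.
Proof.
move=> hu; have := distribution_lin (-1) hu (@smooth_cst R E 0) (@smooth_cst R E 0).
rewrite (_ : (fun _ => _) = fun=> 0); last by apply/funext => x; rewrite mulr0 addr0.
by rewrite rmorphN1 mulN1r addNr.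
Qed.

Lemma distributionZ u (a : R) (f : E -> R) : compactly_supported_distribution u ->
  smooth f -> u (fun x => a * f x) = a%:C * u f.
Proof.
move=> hu sf; rewrite -[RHS]addr0 -(distribution0 hu) -distribution_lin//; last exact: smooth_cst.
by congr u; apply/funext => x; rewrite addr0.
Qed.

Lemma dist_dxisE (l : seq 'I_n) (U : functional R (E * E)) phi :
  dist_dxis l U phi = (-1) ^+ size l * U (iterD phi (rev [seq Y_ a | a <- l])).
Proof.
elim: l phi => [|a l IH] phi /=; first by rewrite mul1r.
rewrite /dist_dxi -/(dist_dxis l U) IH exprS mulN1r mulNr; congr (- (_ * U _)).
by rewrite rev_cons -cats1 iterD_cat.
Qed.

Lemma dist_dxsE (l : seq 'I_n) (U : functional R (E * E)) phi :
  dist_dxs l U phi = (-1) ^+ size l * U (iterD phi (rev [seq X_ a | a <- l])).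
Proof.
elim: l phi => [|a l IH] phi /=; first by rewrite mul1r.
rewrite /dist_dx -/(dist_dxs l U) IH exprS mulN1r mulNr; congr (- (_ * U _)).
by rewrite rev_cons -cats1 iterD_cat.
Qed.

Section Transform.
Context {m : nat} (F : mixed_tensor_field R n m).
Hypothesis hF : mixed_tensor_distribution F.

(** The pairing of the whole field F with A_k, the weights xi^I of the components
being differentiated along d. *)
Definition contracted_ray (k : nat) (d : seq 'I_n) phi : R[i] :=
  \sum_(p < m.+1) \sum_(l : p.-tuple 'I_n)
    F l (ray_adjoint k (mul_xi (iterD (monomial l) [seq e_ b | b <- d]) phi)).

Let hFl (p : 'I_m.+1) (l : p.-tuple 'I_n) : compactly_supported_distribution (F l).
Proof. by case: (hF p). Qed.

Let smon p (l : p.-tuple 'I_n) (d : seq 'I_n) :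
  smooth (iterD (@monomial R n p l) [seq e_ b | b <- d]).
Proof. exact/smooth_iterD/smooth_monomial. Qed.

Lemma contracted_ray_lin k d a phi chi : ray_test phi -> ray_test chi ->
  contracted_ray k d (fun z => a * phi z + chi z) =
  a%:C * contracted_ray k d phi + contracted_ray k d chi.
Proof.
move=> tp tx; rewrite /contracted_ray mulr_sumr -big_split /=; apply: eq_bigr => p _.
rewrite mulr_sumr -big_split /=; apply: eq_bigr => l _.
have t1 := ray_test_mul_xi (smon l d) tp; have t2 := ray_test_mul_xi (smon l d) tx.
rewrite -(distribution_lin a (hFl l) (smooth_ray_adjoint k t1) (smooth_ray_adjoint k t2)).
rewrite -(ray_adjoint_linear k a t1 t2); congr (F l (ray_adjoint k _)).
by apply/funext => z; rewrite /mul_xi; ring.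
Qed.

Lemma contracted_ray0 k d : contracted_ray k d (fun=> 0) = 0.
Proof.
have := contracted_ray_lin k d (-1) (@ray_test0 R n) (@ray_test0 R n).
rewrite (_ : (fun _ => _) = fun=> 0); last by apply/funext => z; rewrite mulr0 addr0.
by rewrite rmorphN1 mulN1r addNr.
Qed.

Lemma contracted_ray_sum k d (I : Type) (r : seq I) (phi : I -> E * E -> R) :
  (forall i, ray_test (phi i)) ->
  contracted_ray k d (fun z => \sum_(i <- r) phi i z) =
  \sum_(i <- r) contracted_ray k d (phi i).
Proof.
move=> tp; elim: r => [|i r IH].
  rewrite (_ : (fun _ => _) = fun=> 0); last by apply/funext => z; rewrite big_nil.
  by rewrite big_nil contracted_ray0.
rewrite (_ : (fun _ => _) = fun z => 1 * phi i z + \sum_(j <- r) phi j z); last first.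
  by apply/funext => z; rewrite big_cons mul1r.
rewrite contracted_ray_lin//; last exact: ray_test_sum.
by rewrite big_cons IH rmorph1 mul1r.
Qed.

Lemma contracted_ray_step k d y phi : ray_test phi ->
  contracted_ray k d ('D_(0, e_ y) phi) =
  contracted_ray k.+1 d ('D_(e_ y, 0) phi) - contracted_ray k (y :: d) phi.
Proof.
move=> tp; rewrite /contracted_ray -sumrB; apply: eq_bigr => p _.
rewrite -sumrB; apply: eq_bigr => l _.
have t1 := ray_test_mul_xi (smon l (y :: d)) tp.
have t2 := ray_test_mul_xi (smon l d) (ray_test_derive (e_ y, 0) tp).
rewrite (ray_adjoint_mul_dxi k (e_ y) (smon l d) tp).
rewrite (distribution_lin (-1) (hFl l) (smooth_ray_adjoint k t1) (smooth_ray_adjoint k.+1 t2)).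
by rewrite rmorphN1 mulN1r addrC.
Qed.

Lemma generalized_momentum_rayE k phi :
  generalized_momentum_ray k F phi = contracted_ray k [::] phi.
Proof.
rewrite /generalized_momentum_ray /contracted_ray; apply: eq_bigr => p _.
rewrite /momentum_ray; apply: eq_bigr => l _.
by rewrite momentum_adjointE.
Qed.

(** The function Z of [alternation] for a test function phi: the moment is the
number of x-derivatives. *)
Definition ray_derivatives phi (t l d : seq 'I_n) : R[i] :=
  contracted_ray (size t) d (iterD phi ([seq Y_ a | a <- l] ++ [seq X_ a | a <- t])).

Lemma ray_derivatives_step phi : ray_test phi -> forall t y l d,
  ray_derivatives phi t (y :: l) d =
  ray_derivatives phi (y :: t) l d - ray_derivatives phi t l (y :: d).
Proof.
move=> tp t y l d; rewrite /ray_derivatives /=.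
rewrite contracted_ray_step; last exact: ray_test_iterD.
congr (contracted_ray _ _ _ - _); have [sp _] := tp.
rewrite -[LHS]/(iterD phi ((e_ y, 0) :: [seq Y_ a | a <- l] ++ [seq X_ a | a <- t])).
by apply: (iterD_perm sp); rewrite -cat_cons -cat1s -catA perm_catCA.
Qed.

Lemma ray_derivatives_perm phi : ray_test phi -> forall t t' l d,
  perm_eq t t' -> ray_derivatives phi t l d = ray_derivatives phi t' l d.
Proof.
move=> [sp _] t t' l d tt'; rewrite /ray_derivatives (perm_size tt').
by congr contracted_ray; apply: (iterD_perm sp); rewrite perm_cat2l perm_map.
Qed.

Lemma alternating_sumE j (i : j.-tuple 'I_n) phi : ray_test phi ->
  alternating_sum F i phi = (-1) ^+ j * alternation (ray_derivatives phi) i [::].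
Proof.
move=> tp; have [sp _] := tp.
rewrite /alternating_sum /alternation size_tuple mulr_sumr; apply: eq_bigr => k _.
rewrite dist_dxsE dist_dxisE generalized_momentum_rayE [RHS]mulrCA; congr (_ * _).
have kj : (k <= j)%N by rewrite -ltnS.
rewrite mulrA -exprD size_drop size_takel size_tuple// subnKC//; congr (_ * _).
rewrite /ray_derivatives size_takel ?size_tuple//; congr contracted_ray.
rewrite -iterD_cat; apply: (iterD_perm sp).
by apply: perm_cat; rewrite perm_rev.
Qed.

(** Where the ranks are separated: the factor of [ray_adjoint_iter_div_xi] with
k = m - j and q = p - j kills the ranks p > j, and j derivatives kill the weights
of rank p < j. *)
Lemma contracted_ray_iter_div (j : 'I_m.+1) (i : j.-tuple 'I_n) psi : ray_test psi ->
  contracted_ray 0 i (iter_div_xi (m - j) psi) =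
  (m - j)`!%:R * j`!%:R * F i (ray_adjoint 0 psi).
Proof.
move=> tp; rewrite /contracted_ray (bigD1 j)//= [X in _ + X]big1 ?addr0.
  pose c (l : j.-tuple 'I_n) := iterD (@monomial R n j l) [seq e_ b | b <- i] 0.
  rewrite -mulrA -(@symmetric_contraction R n j (fun l => F l (ray_adjoint 0 psi)) i); last first.
    by move=> s l; have [_ sF] := hF j; apply: sF; exact: smooth_ray_adjoint.
  rewrite mulr_sumr; apply: eq_bigr => l _.
  have hh := homogeneous_iterD [seq e_ b | b <- i] (homogeneous_monomial l).
  rewrite (ray_adjoint_iter_div_xi _ hh tp) size_map size_tuple subrr subr0.
  have -> : \prod_(r < m - j) (1 + r%:R) = (m - j)`!%:R :> R.
    elim: (m - j)%N => [|k IH]; first by rewrite big_ord0.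
    by rewrite big_ord_recr /= IH factS natrM mulrC -natr1 addrC.
  rewrite (distributionZ _ (hFl l)); last exact/smooth_ray_adjoint/ray_test_mul_xi.
  rewrite rmorph_nat; congr (_ * _).
  rewrite -(distributionZ _ (hFl l)); last exact: smooth_ray_adjoint.
  congr (F l _).
  have := ray_adjoint_linear 0 (c l) tp (@ray_test0 R n); rewrite ray_adjoint0 => H.
  transitivity (ray_adjoint 0 (fun z => c l * psi z + 0)).
    congr (ray_adjoint 0); apply/funext => z; rewrite /mul_xi addr0.
    by rewrite iterD_monomial_cst// size_tuple.
  by rewrite H; apply/funext => x; rewrite addr0.
move=> p pj; apply: big1 => l _; rewrite -[RHS](distribution0 (hFl l)); congr (F l _).
have [jp|pj'|E] := ltngtP j p; last by rewrite (val_inj E) eqxx in pj.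
  have hh := homogeneous_iterD [seq e_ b | b <- i] (homogeneous_monomial l).
  rewrite (ray_adjoint_iter_div_xi _ hh tp) size_map size_tuple.
  (* The factor of index r = p - j - 1 is 1 - (p - j) + r = 0. *)
  have pm := ltn_ord p; have rk : (p - j - 1 < m - j)%N by lia.
  have f0 : 1 - (p%:R - j%:R) + (p - j - 1)%:R = 0 :> R.
    by rewrite !natrB; [ring|lia|lia].
  by apply/funext => x; rewrite (bigD1 (Ordinal rk))//= f0 !mul0r.
rewrite iterD_monomial_vanish ?size_tuple//.
rewrite (_ : mul_xi _ _ = fun=> 0) ?ray_adjoint0//.
by apply/funext => z; rewrite /mul_xi mul0r.
Qed.

End Transform.
End Assembly.

Local Close Scope complex_scope.

Theorem theorem4p10 (R : realType) (n m : nat) (F : mixed_tensor_field R n m) :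
  (2 <= n)%N -> mixed_tensor_distribution F ->
  forall (j : 'I_m.+1) (i : j.-tuple 'I_n)
    (psi : 'rV[R]_n * 'rV[R]_n -> R), test_function psi ->
    momentum_ray 0 (scalar_field (F j i)) psi =
    (-1) ^+ (m - j) / ((m - j)`!%:R * j`!%:R) *
    symmetrize (fun i' => dist_P (m - j) (alternating_sum F i')) i psi.
Proof.
move=> n2 hF j i psi /test_function_ray_test tp.
have -> : momentum_ray 0 (scalar_field (F j i)) psi = F j i (ray_adjoint 0 psi).
  rewrite /momentum_ray (big_pred1 [tuple]) /=; last first.
    by move=> l; apply/esym/eqP; exact: tuple0.
  rewrite momentum_adjointE; congr (F j i (ray_adjoint 0 _)); apply/funext => z.
  by rewrite /monomial big_ord0 mul1r.
pose phi (l : (m - j).-tuple 'I_n) :=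
  iterD (mul_xi (monomial l) psi) [seq (0, basis_vec R a) | a <- l].
have tphi l : ray_test (phi l).
  by apply/ray_test_iterD/ray_test_mul_xi => //; exact: smooth_monomial.
have sphi (l : (m - j).-tuple 'I_n) : smooth (mul_xi (monomial l) psi).
  by case: (ray_test_mul_xi (@smooth_monomial R n (m - j) l) tp).
have PE s : dist_P (m - j) (alternating_sum F (perm_tuple s i)) psi =
    (-1) ^+ (m - j) * \sum_(l : (m - j).-tuple 'I_n) alternating_sum F (perm_tuple s i) (phi l).
  rewrite /dist_P mulr_sumr; apply: eq_bigr => l _.
  rewrite /dist_mulxi dist_dxisE size_tuple; congr (_ * alternating_sum F _ _).
  by apply: (iterD_perm (sphi l)); rewrite perm_rev.
have SE : \sum_(s : 'S_j) dist_P (m - j) (alternating_sum F (perm_tuple s i)) psi =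
    (-1) ^+ (m - j) * (j`!%:R * ((m - j)`!%:R * j`!%:R * F j i (ray_adjoint 0 psi))).
  rewrite (eq_bigr _ (fun s _ => PE s)) -mulr_sumr; congr (_ * _).
  rewrite exchange_big /= -contracted_ray_iter_div// contracted_ray_sum//.
  rewrite mulr_sumr; apply: eq_bigr => l _.
  rewrite (eq_bigr (fun s => (-1) ^+ j * alternation (ray_derivatives F (phi l))
    (perm_tuple s i) [::])); last by move=> s _; exact: alternating_sumE.
  rewrite -mulr_sumr alternation_sum; last 2 first.
  - exact: ray_derivatives_step.
  - exact: ray_derivatives_perm.
  rewrite mulrA -exprMn mulrNN mulr1 expr1n mul1r.
  rewrite (eq_bigr (fun=> contracted_ray F 0 i (phi l))); last first.
    move=> s _; rewrite /ray_derivatives /=; apply: eq_bigr => p _.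
    apply: eq_bigr => q _; congr (F p q (ray_adjoint 0 (mul_xi _ _))).
    apply: (iterD_perm (smooth_monomial q)); apply: perm_map.
    by apply/tuple_permP; exists s.
  by rewrite sumr_const card_Sn mulr_natl.
rewrite /symmetrize SE.
have f1 : (m - j)`!%:R != 0 :> R[i]%C by rewrite pnatr_eq0 -lt0n fact_gt0.
have f2 : j`!%:R != 0 :> R[i]%C by rewrite pnatr_eq0 -lt0n fact_gt0.
have sgn : (-1) ^+ (m - j) * (-1) ^+ (m - j) = 1 :> R[i]%C.
  by rewrite -exprMn mulrNN mulr1 expr1n.
by field: sgn; rewrite f2 f1.
Qed.
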